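(* Let $\alpha>-1$, $1<p\le q<\infty$ and $0\le\gamma<2+\alpha$. Let $\Phi\in B_p$ and let $\Psi$ be its complementary function. Let $\omega$ be a weight and $\mu$ a positive Borel measure on $\mathcal H$ such that for some $C>0$ and every interval $I\subset\mathbb R$, $$|Q_I|_\alpha^{q(\frac{\gamma}{2+\alpha}-\frac1p)}\,\|\omega^{-1}\|_{Q_I,\Psi,\alpha}^q\,\mu(Q_I)\le C.$$ Then there is $K>0$ such that for every $f\in L^p(\mathcal H,\omega dV_\alpha)$, $$\left(\int_{\mathcal H}(\mathcal M_{\alpha,\gamma}f)^q\,d\mu\right)^{1/q}\le K\|f\omega\|_{p,\alpha}.$$
   Context: $\mathcal H=\{x+iy:x\in\mathbb R,\ y>0\}$; for $\alpha>-1$, $dV_\alpha(x+iy)=y^\alpha dx\,dy$; $\|g\|_{p,\alpha}=(\int_{\mathcal H}|g|^pdV_\alpha)^{1/p}$. A weight is a nonnegative locally integrable function. For an interval $I$, $Q_I=\{x+iy:x\in I,0<y<|I|\}$, $|Q_I|_\alpha=\int_{Q_I}dV_\alpha$. $\mathcal M_{\alpha,\gamma}f(z)=\sup\{|I|^{-(2+\alpha-\gamma)}\int_{Q_I}|f|dV_\alpha: I\subset\mathbb R\text{ interval}, z\in Q_I\}$. A Young function is a continuous convex increasing $\Phi:[0,\infty)\to[0,\infty)$ with $\Phi(0)=0$ and $\Phi(t)\to\infty$ as $t\to\infty$. Its complementary function is $\Psi(s)=\sup_{t\ge0}(ts-\Phi(t))$. The Luxemburg norm is $\|f\|_{Q_I,\Phi,\alpha}=\inf\{\lambda>0:\frac1{|Q_I|_\alpha}\int_{Q_I}\Phi(|f|/\lambda)dV_\alpha\le1\}$.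 For $1<p<\infty$, $\Phi\in B_p$ means $\Phi$ satisfies the $\Delta_2$ condition (there is $K>1$ with $\Phi(2t)\le K\Phi(t)$ for all $t\ge0$) and $\int_c^\infty\frac{\Phi(t)}{t^p}\frac{dt}{t}<\infty$ for some $c>0$. *)

(* Defs.v *)
From HB Require Import structures.
From mathcomp Require Import all_boot all_order all_algebra.
From mathcomp Require Import all_classical all_reals all_analysis.
Set Implicit Arguments. Unset Strict Implicit. Unset Printing Implicit Defensive.
Import Order.TTheory GRing.Theory Num.Theory.
Import numFieldNormedType.Exports.
Local Open Scope classical_set_scope.
Local Open Scope ring_scope.

Section Defs.
Variable R : realType.

Definition leb2 := ((@lebesgue_measure R) \x (@lebesgue_measure R))%E.

Definition Hplane : set (R * R) := [set z | 0 < z.2].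

Definition dVint (alpha : R) (A : set (R * R)) (h : R * R -> \bar R) : \bar R :=
  (\int[leb2]_(z in A) (h z * (z.2 `^ alpha)%:E))%E.

(* A bounded interval I of R with endpoints a < b; ba/bb select whether
   each endpoint is included ([BSide true a] = closed at a,
   [BSide false b] = closed at b). Its length |I| is b - a. *)
Definition itv (a b : R) (ba bb : bool) : set R :=
  [set` Interval (BSide ba a) (BSide bb b)].

Definition Qbox (a b : R) (ba bb : bool) : set (R * R) :=
  [set z | itv a b ba bb z.1 /\ 0 < z.2 < b - a].

Definition volQ (alpha : R) (a b : R) (ba bb : bool) : \bar R :=
  dVint alpha (Qbox a b ba bb) (fun _ => 1%E).

Definition Mag (alpha gamma : R) (f : R * R -> R) (z : R * R) : \bar R :=
  ereal_sup [set v : \bar R | exists (a b : R) (ba bb : bool),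
     [/\ a < b, Qbox a b ba bb z &
      v = (((b - a) `^ (- (2 + alpha - gamma)))%:E *
             dVint alpha (Qbox a b ba bb) (fun w => (`|f w|)%:E))%E]].

Definition Young (Phi : R -> R) : Prop :=
  [/\ {within `[0, +oo[, continuous Phi} /\ Phi 0 = 0,
      (forall x y t, 0 <= x -> 0 <= y -> 0 <= t <= 1 ->
         Phi (t * x + (1 - t) * y) <= t * Phi x + (1 - t) * Phi y),
      (forall x y, 0 <= x -> x < y -> Phi x < Phi y),
      (forall t, 0 <= t -> 0 <= Phi t) &
      Phi x @[x --> +oo] --> +oo].

Definition Delta2 (Phi : R -> R) : Prop :=
  exists K : R, 1 < K /\ forall t, 0 <= t -> Phi (2 * t) <= K * Phi t.

Definition Bp (p : R) (Phi : R -> R) : Prop :=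
  Delta2 Phi /\
  exists c : R, 0 < c /\
    (\int[@lebesgue_measure R]_(t in `[c, +oo[) ((Phi t / t `^ p) / t)%:E < +oo)%E.

Definition compl (Phi : R -> R) (s : R) : \bar R :=
  ereal_sup [set (t * s - Phi t)%:E | t in `[0, +oo[%classic].

Definition extE (Theta : R -> \bar R) (x : \bar R) : \bar R :=
  match x with
  | r%:E => Theta r
  | +oo%E => +oo%E
  | -oo%E => 0%E
  end.

Definition luxemburg (alpha : R) (Theta : R -> \bar R) (g : R * R -> \bar R)
    (a b : R) (ba bb : bool) : \bar R :=
  ereal_inf [set lam%:E | lam in [set lam : R | 0 < lam /\
     (((fine (volQ alpha a b ba bb))^-1)%:E *
        dVint alpha (Qbox a b ba bb) (fun z => extE Theta (g z * (lam^-1)%:E))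
      <= 1)%E]].

Definition winv (omega : R * R -> R) (z : R * R) : \bar R :=
  if omega z == 0 then +oo%E else ((omega z)^-1)%:E.

Definition weight (omega : R * R -> R) : Prop :=
  [/\ measurable_fun Hplane omega,
      (forall z, Hplane z -> 0 <= omega z) &
      forall K : set (R * R), compact K -> K `<=` Hplane ->
        (\int[leb2]_(z in K) (omega z)%:E < +oo)%E].

End Defs.
Arguments Hplane {R}.

(* Main.v *)
(* Fix the intervals J = [m 2^k, (m + 2) 2^k); every interval I lies in some J
   with |J| <= 4 |I|, so (M f)^q is at most a constant times the sum over J of
   A_J^q 1_{Q_J}, A_J being the normalized average of |f| over Q_J, and
   integrating against mu leaves the sum of A_J^q mu(Q_J) to be bounded.
   Put g = |f omega| and S_j = Phi(g / 2^j) where g > 2^j, S_j = 0 elsewhere.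
   If j(J) is such that over Q_J the mean of S_j exceeds 1 for j = j(J) but not
   for j = j(J) + 1, Young's inequality and the hypothesis give
     A_J^q mu(Q_J) <= const * (2^{j p} |Q_J|)^{q/p},  j = j(J),
   and since q >= p it remains to bound the sum over J of 2^{j(J) p} |Q_J|.
   The boxes J on which S_j has mean > 1 have total volume at most
   const * int S_j: no stopping argument is needed because the volumes of the
   dyadic Carleson boxes below a given one form a convergent geometric series
   (alpha > -1). Finally sum_j 2^{j p} S_j <= const * g^p is a discrete form of
   Phi in B_p. *)
Require Import Defs.
From HB Require Import structures.
From mathcomp Require Import all_boot all_order all_algebra.
From mathcomp Require Import all_classical all_reals all_analysis.
From mathcomp Require Import measurable_realfun ring lra zify.
Import Order.TTheory GRing.Theory Num.Theory.
Import numFieldNormedType.Exports.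
Local Open Scope classical_set_scope.
Local Open Scope ring_scope.
Set Implicit Arguments.
Unset Strict Implicit.

(** * Integration against y^alpha dx dy *)

Section plane_measure.
Variable R : realType.
Implicit Types (A B : set (R * R)) (h : R * R -> \bar R).

(** The product measure [leb2] with its measure structure recorded in the type, the form in which
    the integration lemmas are applied to it. *)
Definition lebesgue2 : {measure set (measurableTypeR R * measurableTypeR R) -> \bar R} :=
  ((@lebesgue_measure R) \x (@lebesgue_measure R))%E.

Lemma measurable_Hplane : measurable (@Hplane R).
Proof.
rewrite (_ : Hplane = setT `*` `]0, +oo[%classic).
  exact: measurableX.
by apply/seteqP; split => z /=; rewrite /Hplane /= in_itv/= andbT => // -[].
Qed.

Lemma measurable_Qbox (a b : R) ba bb : measurable (Qbox a b ba bb).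
Proof.
rewrite (_ : Qbox a b ba bb = itv a b ba bb `*` `]0, b - a[%classic).
  by apply: measurableX => //; exact: measurable_itv.
by apply/seteqP; split => z /=; rewrite /Qbox /= in_itv/=.
Qed.

Lemma Qbox_Hplane (a b : R) ba bb : Qbox a b ba bb `<=` Hplane.
Proof. by move=> z [_ /andP[]]. Qed.

Lemma measurable_snd_powR (alpha : R) A :
  measurable_fun A (fun z : R * R => (z.2 `^ alpha)%:E).
Proof.
apply/measurable_EFinP; apply: (measurable_funTS (f := (powR (R:=R))^~ alpha \o snd)).
by apply: measurableT_comp => //; exact: measurable_powR.
Qed.

Variable alpha : R.

Lemma measurable_dVint A h : measurable_fun A h ->
  measurable_fun A (fun z => h z * (z.2 `^ alpha)%:E)%E.
Proof. by move=> mh; apply: emeasurable_funM => //; exact: measurable_snd_powR. Qed.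

Lemma dVint_ge0 A h : (forall z, A z -> 0 <= h z)%E -> (0 <= dVint alpha A h)%E.
Proof.
by move=> h0; apply: integral_ge0 => z Az; rewrite mule_ge0 ?h0// lee_fin powR_ge0.
Qed.

Lemma le_dVint A h1 h2 : measurable A -> (forall z, A z -> 0 <= h1 z)%E ->
  measurable_fun A h1 -> measurable_fun A h2 ->
  (forall z, A z -> h1 z <= h2 z)%E -> (dVint alpha A h1 <= dVint alpha A h2)%E.
Proof.
move=> mA h10 mh1 mh2 h12.
apply: (@ge0_le_integral _ _ _ lebesgue2); first exact: mA.
- by move=> z Az; rewrite mule_ge0 ?h10// lee_fin powR_ge0.
- exact: (measurable_dVint mh1).
- exact: (measurable_dVint mh2).
- by move=> z Az; rewrite lee_wpmul2r ?h12// lee_fin powR_ge0.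
Qed.

Lemma dVint_subset A B h : measurable A -> measurable B ->
  measurable_fun B h -> (forall z, B z -> 0 <= h z)%E -> A `<=` B ->
  (dVint alpha A h <= dVint alpha B h)%E.
Proof.
move=> mA mB mh h0 AB.
apply: (@ge0_subset_integral _ _ _ lebesgue2); [exact: mA|exact: mB| | |exact: AB].
- exact: (measurable_dVint mh).
- by move=> z Az; rewrite mule_ge0 ?h0// lee_fin powR_ge0.
Qed.

Lemma dVintD A h1 h2 : measurable A ->
  measurable_fun A h1 -> (forall z, A z -> 0 <= h1 z)%E ->
  measurable_fun A h2 -> (forall z, A z -> 0 <= h2 z)%E ->
  dVint alpha A (fun z => h1 z + h2 z)%E = (dVint alpha A h1 + dVint alpha A h2)%E.
Proof.
move=> mA mh1 h10 mh2 h20; rewrite /dVint.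
rewrite -(@ge0_integralD _ _ _ lebesgue2); first last.
- exact: (measurable_dVint mh2).
- by move=> z Az; rewrite mule_ge0 ?h20// lee_fin powR_ge0.
- exact: (measurable_dVint mh1).
- by move=> z Az; rewrite mule_ge0 ?h10// lee_fin powR_ge0.
- exact: mA.
apply: eq_integral => z /[!inE] Az.
by rewrite ge0_muleDl ?h10 ?h20.
Qed.

Lemma dVintZl A h (k : R) : measurable A ->
  measurable_fun A h -> (forall z, A z -> 0 <= h z)%E -> 0 <= k ->
  dVint alpha A (fun z => k%:E * h z)%E = (k%:E * dVint alpha A h)%E.
Proof.
move=> mA mh h0 k0; rewrite /dVint.
rewrite -(@ge0_integralZl _ _ _ lebesgue2); first last.
- by rewrite lee_fin.
- by move=> z Az; rewrite mule_ge0 ?h0// lee_fin powR_ge0.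
- exact: (measurable_dVint mh).
- exact: mA.
by apply: eq_integral => z _; rewrite muleA.
Qed.

Lemma dVint_cst A (k : R) : measurable A -> 0 <= k ->
  dVint alpha A (fun=> k%:E) = (k%:E * dVint alpha A (fun=> 1))%E.
Proof.
move=> mA k0; rewrite -dVintZl//.
by apply: eq_integral => z _; rewrite mule1.
Qed.

Lemma dVint_setU A B h : measurable A -> measurable B ->
  measurable_fun (A `|` B) h -> (forall z, (A `|` B) z -> 0 <= h z)%E ->
  [disjoint A & B] -> 
  dVint alpha (A `|` B) h = (dVint alpha A h + dVint alpha B h)%E.
Proof.
move=> mA mB mh h0 AB; rewrite /dVint.
rewrite (@ge0_integral_setU _ _ _ lebesgue2)//.
- exact: (measurable_dVint mh).
- by move=> z Az; rewrite mule_ge0 ?h0// lee_fin powR_ge0.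
Qed.

Lemma dVint_sum A (I : Type) (s : seq I) (h : I -> R * R -> \bar R) : measurable A ->
  (forall i, measurable_fun A (h i)) -> (forall i z, A z -> 0 <= h i z)%E ->
  (dVint alpha A (fun z => \sum_(i <- s) h i z) =
   \sum_(i <- s) dVint alpha A (h i))%E.
Proof.
move=> mA mh h0; rewrite /dVint.
rewrite -(@ge0_integral_sum _ _ _ lebesgue2); first last.
- by move=> i z Az; rewrite mule_ge0 ?h0// lee_fin powR_ge0.
- by move=> i; exact: (measurable_dVint (mh i)).
- exact: mA.
apply: eq_integral => z /[!inE] Az.
by rewrite ge0_sume_distrl// => i _; exact: h0.
Qed.

End plane_measure.

(** * The volume of Carleson boxes *)

Section volume.
Variable R : realType.
Local Notation mu1 := (@lebesgue_measure R).

(** Fundamental theorem of calculus with antiderivative y^(1 + alpha) / (1 + alpha). The interval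
    stays away from 0, where y^alpha is singular for alpha < 0. *)
Lemma integral_powR_cc (alpha e L : R) : -1 < alpha -> 0 < e -> e < L ->
  (\int[mu1]_(y in `[e, L]) (y `^ alpha)%:E =
   ((L `^ (1 + alpha) - e `^ (1 + alpha)) / (1 + alpha))%:E)%E.
Proof.
move=> a1 e0 eL.
have a0 : 1 + alpha != 0 by rewrite gt_eqF// -ltrBlDl sub0r.
have dF (y : R) : 0 < y -> is_derive y 1 (fun y => (1 + alpha)^-1 * y `^ (1 + alpha)) (y `^ alpha).
  move=> y0.
  have yI : y \in `]0, +oo[ by rewrite in_itv/= y0.
  have d1 : is_derive y 1 (fun y : R => y `^ (1 + alpha)) ((1 + alpha) * y `^ (1 + alpha - 1)).
    apply: DeriveDef; first exact: derivable_powR.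
    by rewrite -derive1E powR_derive1.
  have := is_deriveZ (1 + alpha)^-1 d1.
  by rewrite /GRing.scale/= mulrA mulVf// mul1r addrAC subrr add0r.
have cF (y : R) : 0 < y -> {for y, continuous (fun y : R => (1 + alpha)^-1 * y `^ (1 + alpha))}.
  move=> y0; apply: differentiable_continuous; apply/derivable1_diffP.
  by have [] := dF _ y0.
rewrite (@continuous_FTC2 _ _ (fun y : R => (1 + alpha)^-1 * y `^ (1 + alpha)))//.
- by rewrite -EFinB -mulrBr mulrC.
- apply: continuous_in_subspaceT => y /[!inE]/= /[!in_itv]/= /andP[ey _].
  have y0 : 0 < y by exact: lt_le_trans ey.
  apply: differentiable_continuous; apply/derivable1_diffP.
  by apply: derivable_powR; rewrite in_itv/= y0.
- split.
  + move=> y /[!in_itv]/= /andP[ey _].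
    by have [] := dF _ (lt_trans e0 ey).
  + by apply: cvg_at_right_filter; apply: cF.
  + by apply: cvg_at_left_filter; apply: cF; exact: lt_trans eL.
- move=> y /[!in_itv]/= /andP[ey _].
  by rewrite derive1E; have [_ ->] := dF _ (lt_trans e0 ey).
Qed.

Lemma integral_powR_oo (alpha L : R) : -1 < alpha -> 0 < L ->
  (\int[mu1]_(y in `]0%R, L[) (y `^ alpha)%:E = (L `^ (1 + alpha) / (1 + alpha))%:E)%E.
Proof.
move=> a1 L0.
have a0 : 0 < 1 + alpha by rewrite -ltrBlDl sub0r.
have mp D : measurable_fun D (fun y : R => (y `^ alpha)%:E).
  by apply/measurable_EFinP; apply: measurable_funTS; exact: measurable_powR.
rewrite integral_itv_bndo_bndc//.
(* Monotone convergence along this exhaustion reduces to [integral_powR_cc]. The shift to [n.+2]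
   keeps the left endpoint strictly below [L]. *)
have -> : `]0%R, L]%classic = \bigcup_n `[L / n.+2%:R, L]%classic.
  apply/seteqP; split => y /=; last first.
    move=> [n _] /=; rewrite !in_itv/= => /andP[y1 ->]; rewrite andbT.
    by apply: lt_le_trans y1; rewrite divr_gt0.
  rewrite in_itv/= => /andP[y0 yL].
  exists (Num.truncn (L / y)) => //=; rewrite in_itv/= yL andbT.
  rewrite ler_pdivrMr// mulrC -ler_pdivrMr//.
  apply: ltW; apply: lt_trans (truncnS_gt _) _.
  by rewrite ltr_nat.
have nd : {homo (fun n : nat => (`[L / n.+2%:R, L]%classic : set R)) : n m / (n <= m)%N >-> (n <= m)%O}.
  move=> n m nm; apply/subsetPset => y /=; rewrite !in_itv/= => /andP[y1 ->]; rewrite andbT.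
  apply: le_trans y1; rewrite ler_pM2l// lef_pV2 ?posrE// ler_nat.
  by rewrite !ltnS.
have := @ge0_nondecreasing_set_cvg_integral _ (measurableTypeR R) R _ (fun y : R => (y `^ alpha)%:E) mu1 nd.
move=> /(_ (fun=> measurable_itv _) (fun i => mp _)) /=.
have h0 (i : nat) (x : R) : `[L / i.+2%:R, L]%classic x -> (0 <= (x `^ alpha)%:E)%E.
  by rewrite lee_fin powR_ge0.
move=> /(_ h0)/cvg_lim <-//.
apply/cvg_lim => //.
rewrite [X in X @ _ --> _](_ : _ = fun n : nat =>
  ((L `^ (1 + alpha) - (L / n.+2%:R) `^ (1 + alpha)) / (1 + alpha))%:E); last first.
  apply/funext => n; rewrite integral_powR_cc ?divr_gt0//.
  by rewrite ltr_pdivrMr// ltr_pMr// ltr1n.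
apply: cvg_EFin; first by near=> n.
rewrite -[X in _ --> X]mul1r mul1r.
apply: cvgMl.
rewrite -[X in _ --> X]subr0; apply: cvgB; first exact: cvg_cst.
have := @powR_cvg0 R (1 + alpha) a0.
move=> /cvg_at_rightP; apply; split; first by move=> n; rewrite divr_gt0.
rewrite -(mulr0 L); apply: cvgMr.
have := @cvg_harmonic R; rewrite -cvg_shiftS; exact.
Unshelve. all: by end_near. Qed.

Lemma volQE (alpha a b : R) ba bb : -1 < alpha -> a < b ->
  volQ alpha a b ba bb = ((b - a) `^ (2 + alpha) / (1 + alpha))%:E.
Proof.
move=> a1 ab.
have L0 : 0 < b - a by rewrite subr_gt0.
have mQ := @measurable_Qbox R a b ba bb.
rewrite /volQ /dVint.
have -> : (\int[@leb2 R]_(z in Qbox a b ba bb) (1 * (z.2 `^ alpha)%:E) =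
  \int[@lebesgue2 R]_(z in Qbox a b ba bb) (z.2 `^ alpha)%:E)%E.
  by apply: eq_integral => z _; rewrite mul1e.
(* By Tonelli the integral splits into the length of the base times the integral of y^alpha over the
   height. *)
rewrite integral_mkcond fubini_tonelli1//; first last.
- by move=> z; rewrite patchE; case: ifP => // _; rewrite lee_fin powR_ge0.
- apply/(measurable_restrictT _ (mQ : measurable (Qbox a b ba bb : set (measurableTypeR R * measurableTypeR R)))).
  exact: (measurable_snd_powR alpha).
rewrite /fubini_F.
under eq_integral => x _.
  rewrite (_ : (fun y => _) = fun y => ((\1_(itv a b ba bb) x)%:E *
      ((fun y => (y `^ alpha)%:E) \_ `]0%R, (b - a)%R[) y)%E); last first.
    apply/funext => y; rewrite !patchE indicE.
    rewrite (_ : ((x, y) \in Qbox a b ba bb) = (x \in itv a b ba bb) && (y \in `]0, b - a[%classic)); last first.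
      apply/idP/andP; rewrite !inE /Qbox /= in_itv/= => -[] //.
    by case: (x \in _) => /=; rewrite ?mul1e ?mul0e.
  rewrite ge0_integralZl//; last 2 first.
  - apply: (measurable_restrictT _ _).1; first exact: measurable_itv.
    by apply/measurable_EFinP; apply: measurable_funTS; exact: measurable_powR.
  - by move=> y _; rewrite patchE; case: ifP => // _; rewrite lee_fin powR_ge0.
  rewrite -integral_mkcond integral_powR_oo//.
  over.
rewrite /= ge0_integralZr//; last first.
- by rewrite lee_fin divr_ge0 ?powR_ge0// -lerBlDl sub0r ltW.
- by apply/measurable_EFinP; apply: measurable_indic; exact: measurable_itv.
rewrite integral_indic//; last exact: measurable_itv.
rewrite setIT.
have -> : (lebesgue_measure : measure (measurableTypeR R) R) (itv a b ba bb) = (b - a)%:E.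
  by rewrite /= /itv lebesgue_measure_itv /= lte_fin ab.
rewrite -EFinM; congr (_ %:E); rewrite mulrA; congr (_ / _).
have -> : 1 + alpha = (2 + alpha) - 1 by lra.
by rewrite mulr_powRB1 ?(ltW L0)//; lra.
Qed.
End volume.

(** * Packing dyadic Carleson boxes *)

Section dyadic.
Variable R : realType.
Implicit Types (k m : int) (x r : int * int).

(** A pair (k, m) codes the dyadic interval [m 2^k, (m + 1) 2^k); the floor quotient gives the
    dyadic interval of twice the length that contains it. *)
Definition dyadic_parent x : int * int := (x.1 + 1, (x.2 %/ 2)%Z).

Lemma iter_dyadic_parent1 i x : (iter i dyadic_parent x).1 = x.1 + i%:Z.
Proof. elim: i => [|i /= ->]; first by rewrite addr0. by rewrite -addrA -PoszD addn1. Qed.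

(** Floor division by 2 maps the range [-i - 2, i + 1] into [-i - 1, i] and fixes 0 and -1.
    Geometrically, no dyadic interval straddles 0. *)
Lemma iter_dyadic_parent2 i x : - (i%:Z) - 1 <= x.2 -> x.2 <= i%:Z ->
  (iter i dyadic_parent x).2 = 0 \/ (iter i dyadic_parent x).2 = -1.
Proof.
elim: i x => [|i IH] x; first by move=> /= *; lia.
by move=> x1 x2; rewrite iterSr; apply: IH => /=; lia.
Qed.

(** Climbing K - x.1 >= |x.2| generations reaches scale K with the index already reduced to 0 or -1.
    A finite family of boxes thus hangs below two roots. *)
Lemma dyadic_ancestor (K : nat) x : (`|x.1| + `|x.2| <= K)%N ->
  exists2 i, (i < K.*2.+1)%N & (iter i dyadic_parent x).1 = K /\
   ((iter i dyadic_parent x).2 = 0 \/ (iter i dyadic_parent x).2 = -1).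
Proof.
move=> xK; exists `|K%:Z - x.1|%N; first by rewrite -addnn; lia.
split; first by rewrite iter_dyadic_parent1; lia.
by apply: iter_dyadic_parent2; lia.
Qed.

Lemma dyadic_parentE x r : (dyadic_parent x == r) =
  (x == (r.1 - 1, 2 * r.2)) || (x == (r.1 - 1, 2 * r.2 + 1)).
Proof.
case: x r => k m [k' m']; rewrite /dyadic_parent !xpair_eqE/=.
by apply/idP/idP; lia.
Qed.

Lemma pow2D (a b : R) : 2 `^ (a + b) = 2 `^ a * 2 `^ b.
Proof. by rewrite powRD// pnatr_eq0 implybT. Qed.

Lemma pow2_intmul (k : int) (a : R) : (2 ^ k) `^ a = 2 `^ (k%:~R * a).
Proof. by rewrite -powR_intmul// -powRrM. Qed.

Lemma exp2_pred k : 2 ^ k = 2 * 2 ^ (k - 1) :> R.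
Proof.
have k1 : k = 1 + (k - 1) by rewrite addrC subrK.
by rewrite [in LHS]k1 expfzDr ?pnatr_eq0// expr1z.
Qed.

(** The flags [true true] select the half-open base [a, b), so that the two children of a box are
    disjoint. *)
Definition Qdyadic x : set (R * R) :=
  Qbox (x.2%:~R * 2 ^ x.1) ((x.2 + 1)%:~R * 2 ^ x.1) true true.

Lemma QboxE (a b : R) z :
  Qbox a b true true z = (a <= z.1 < b /\ 0 < z.2 < b - a).
Proof. by rewrite /Qbox /itv /= in_itv. Qed.

Lemma Qdyadic_child (b : bool) r :
  Qdyadic (r.1 - 1, 2 * r.2 + b%:Z) `<=` Qdyadic r.
Proof.
move=> [u v]; rewrite /Qdyadic !QboxE/=.
have e0 : 0 < 2 ^ (r.1 - 1) :> R by rewrite exprz_gt0.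
rewrite (exp2_pred r.1).
set e := 2 ^ (r.1 - 1) in e0 *.
case: b => /= -[/andP[u1 u2] /andP[v1 v2]];
  (split; apply/andP; split => //); move: u1 u2 v2; rewrite !intrD !intrM; lra.
Qed.

Lemma Qdyadic_child_disj r :
  [disjoint Qdyadic (r.1 - 1, 2 * r.2) & Qdyadic (r.1 - 1, 2 * r.2 + 1)].
Proof.
apply/disj_setPLR => -[u v]; rewrite /Qdyadic/= !QboxE/=.
by move=> [/andP[_ u1] _] [/andP[+ _] _]; rewrite leNgt u1.
Qed.

Lemma measurable_Qdyadic x : measurable (Qdyadic x).
Proof. exact: measurable_Qbox. Qed.

Lemma Qdyadic_Hplane x : Qdyadic x `<=` Hplane.
Proof. exact: Qbox_Hplane. Qed.

Variable alpha : R.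
Hypothesis alpha1 : -1 < alpha.

(** By [volQE], the volume of a Carleson box over any interval of length 2^k. *)
Definition Vol k : R := (2 ^ k) `^ (2 + alpha) / (1 + alpha).

Lemma Vol_gt0 k : 0 < Vol k.
Proof. by rewrite /Vol divr_gt0 ?powR_gt0 ?exprz_gt0//; have := alpha1; lra. Qed.

Definition volr : R := 2 `^ (- (2 + alpha)).

Lemma volr_gt0 : 0 < volr. Proof. exact: powR_gt0. Qed.

(** The two children of a box together have the fraction [2 * volr] = 2^-(1 + alpha) of its volume.
    As alpha > -1 this is below 1, so the volumes of successive generations form a convergent
    geometric series. *)
Lemma volr_lt : 0 < 1 - 2 * volr.
Proof.
have -> : 2 * volr = 2 `^ (- (1 + alpha)).
  by rewrite /volr -{1}(@powRr1 R 2)// -pow2D; congr powR; lra.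
rewrite subr_gt0 powRN invf_lt1 ?powR_gt0//.
have a0 : 0 < 1 + alpha by have := alpha1; lra.
have := gt0_ltr_powR a0 (_ : 1 \in Num.nneg) (_ : 2 \in Num.nneg) (ltr1n R 2).
by rewrite powR1; apply; rewrite nnegrE.
Qed.

Lemma VolB1 k : Vol (k - 1) = volr * Vol k.
Proof.
rewrite /Vol /volr mulrA; congr (_ / _).
rewrite !pow2_intmul -pow2D; congr powR.
by rewrite intrB; lra.
Qed.

(** * Volumes summed over the dyadic tree *)

Section tree.
Variables (s : seq (int * int)).
Hypothesis us : uniq s.

(** The total volume of the members of [s] at most [n] generations below [r], sorted by
    generation. *)
Definition tree_sum n r : R :=
  \sum_(i < n.+1) \sum_(x <- s | iter i dyadic_parent x == r) Vol x.1.

Lemma tree_sumS n r : tree_sum n.+1 r = \sum_(x <- s | x == r) Vol x.1 +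
  (tree_sum n (r.1 - 1, 2 * r.2) + tree_sum n (r.1 - 1, 2 * r.2 + 1)).
Proof.
rewrite /tree_sum big_ord_recl /=; congr (_ + _).
rewrite -big_split/=; apply: eq_bigr => i _.
rewrite big_mkcond [in RHS]big_mkcond [X in _ + X]big_mkcond -big_split/=.
apply: eq_bigr => x _; rewrite dyadic_parentE.
case: eqP => [->|_]; last by rewrite add0r.
rewrite xpair_eqE eqxx/=; case: eqP => [|_]; last by rewrite addr0.
by move=> /eqP; rewrite -subr_eq0 opprD addrA subrr.
Qed.

Lemma sum_pred1_le r : \sum_(x <- s | x == r) Vol x.1 <= Vol r.1.
Proof.
have [rs|rs] := boolP (r \in s).
  rewrite -big_filter filter_pred1_uniq// big_seq1//.
rewrite big_seq_cond big1 ?ltW ?Vol_gt0// => x /andP[xs /eqP xr].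
by rewrite -xr xs in rs.
Qed.

(** The bound reproduces itself in the recursion [tree_sumS]: V + 2 volr V / (1 - 2 volr) = V / (1 -
    2 volr). *)
Lemma tree_sum_le n r : tree_sum n r <= Vol r.1 / (1 - 2 * volr).
Proof.
have c0 := volr_lt; have g0 := volr_gt0.
elim: n r => [|n IH] r.
  rewrite /tree_sum big_ord_recl big_ord0 addr0/=.
  apply: (le_trans (sum_pred1_le _)).
  by rewrite ler_pdivlMr// ler_piMr ?ltW ?Vol_gt0//; lra.
rewrite tree_sumS.
apply: le_trans (lerD (sum_pred1_le _) (lerD (IH _) (IH _))) _.
rewrite /= !VolB1 le_eqVlt; apply/orP; left; apply/eqP; field.
by rewrite gt_eqF.
Qed.

Variables (h : R * R -> \bar R) (kappa : R).
Hypothesis mh : measurable_fun Hplane h.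
Hypothesis h0 : forall z, Hplane z -> (0 <= h z)%E.
Hypothesis kappa0 : 0 <= kappa.
Hypothesis Ph : forall x, x \in s ->
  ((Vol x.1)%:E <= kappa%:E * dVint alpha (Qdyadic x) h)%E.

(** Descend from [r]. At a box in [s] the whole subtree costs at most a multiple of the volume of
    that box, for which [Ph] pays. At a box outside [s] the bounds for the two children add up,
    since these are disjoint subsets of it. *)
Lemma tree_sum_int n r : ((tree_sum n r)%:E <=
  (kappa / (1 - 2 * volr))%:E * dVint alpha (Qdyadic r) h)%E.
Proof.
have c0 := volr_lt.
have mhS A : A `<=` Hplane -> measurable_fun A h.
  by move=> AH; apply: measurable_funS mh => //; exact: measurable_Hplane.
have C0 : 0 <= kappa / (1 - 2 * volr) by rewrite divr_ge0// ltW.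
have I0 A : A `<=` Hplane -> (0 <= dVint alpha A h)%E.
  by move=> AH; apply: dVint_ge0 => z /AH; exact: h0.
elim: n r => [|n IH] r; have [rs|rs] := boolP (r \in s).
- rewrite mulrC EFinM -muleA.
  apply: le_trans (lee_wpmul2l _ (Ph rs)); last by rewrite lee_fin invr_ge0 ltW.
  by rewrite -EFinM lee_fin mulrC tree_sum_le.
- rewrite /tree_sum big_ord_recl big_ord0 addr0/= big_seq_cond big1.
    by rewrite mule_ge0 ?lee_fin// I0//; exact: Qdyadic_Hplane.
  by move=> x /andP[xs /eqP xr]; rewrite -xr xs in rs.
- rewrite mulrC EFinM -muleA.
  apply: le_trans (lee_wpmul2l _ (Ph rs)); last by rewrite lee_fin invr_ge0 ltW.
  by rewrite -EFinM lee_fin mulrC tree_sum_le.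
- rewrite tree_sumS big_seq_cond big1 ?add0r; last first.
    by move=> x /andP[xs /eqP xr]; rewrite -xr xs in rs.
  rewrite EFinD; apply: le_trans (leeD (IH _) (IH _)) _.
  have S1 := @Qdyadic_child false r; rewrite addr0 in S1.
  have S2 := @Qdyadic_child true r.
  have SU : Qdyadic (r.1 - 1, 2 * r.2) `|` Qdyadic (r.1 - 1, 2 * r.2 + 1) `<=` Qdyadic r.
    by rewrite subUset; split.
  rewrite -ge0_muleDr ?I0//; try exact: Qdyadic_Hplane.
  apply: lee_wpmul2l; first by rewrite lee_fin.
  have SH := subset_trans SU (@Qdyadic_Hplane r).
  rewrite -dVint_setU//; [|exact: measurable_Qdyadic|exact: measurable_Qdyadic|exact: mhS| |exact: Qdyadic_child_disj].
    apply: dVint_subset => //; try exact: measurable_Qdyadic.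
    + by apply: measurableU; exact: measurable_Qdyadic.
    + by apply: mhS; exact: Qdyadic_Hplane.
    + by move=> z /Qdyadic_Hplane; exact: h0.
  by move=> z /SH; exact: h0.
Qed.

Lemma dyadic_sum_le : ((\sum_(x <- s) Vol x.1)%:E <=
  (2 * kappa / (1 - 2 * volr))%:E * dVint alpha Hplane h)%E.
Proof.
pose K := (\sum_(x <- s) (`|x.1| + `|x.2|))%N.
have sK x : x \in s -> (`|x.1| + `|x.2| <= K)%N.
  by move=> xs; rewrite /K (big_rem x)//= leq_addr.
have c0 := volr_lt.
have C0 : 0 <= kappa / (1 - 2 * volr) by rewrite divr_ge0// ltW.
(* Each box of [s] is counted in one of the two trees with roots at scale [K]: [K.*2] generations
   suffice to climb there. The two roots account for the factor 2. *)
apply: (@le_trans _ _ (tree_sum K.*2 (K%:Z, 0) + tree_sum K.*2 (K%:Z, -1))%:E).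
  rewrite lee_fin /tree_sum -big_split/=.
  have V0 x : 0 <= Vol x.1 by rewrite ltW// Vol_gt0.
  rewrite (eq_bigr (fun i : 'I_K.*2.+1 => \sum_(x <- s)
    ((if iter i dyadic_parent x == (K%:Z, 0) then Vol x.1 else 0) +
     (if iter i dyadic_parent x == (K%:Z, -1) then Vol x.1 else 0)))); last first.
    by move=> i _; rewrite big_split/= -!big_mkcond.
  rewrite exchange_big/= big_seq [leRHS]big_seq; apply: ler_sum => x xs.
  have xK := sK _ xs.
  have [i iK [y1 y2]] := dyadic_ancestor xK.
  rewrite (bigD1 (Ordinal iK))//=.
  set y := iter i _ x in y1 y2 *.
  rewrite -[leLHS]addr0; apply: lerD.
    rewrite [y]surjective_pairing y1.
    by case: y2 => ->; rewrite eqxx /= ?xpair_eqE ?eqxx/= ?addr0 ?add0r.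
  by apply: sumr_ge0 => j _; apply: addr_ge0; case: ifP.
rewrite EFinD; apply: le_trans (leeD (tree_sum_int _ _) (tree_sum_int _ _)) _.
rewrite [X in (_ <= X%:E * _)%E](_ : _ = kappa / (1 - 2 * volr) + kappa / (1 - 2 * volr)); last by field; rewrite gt_eqF.
have le r : ((kappa / (1 - 2 * volr))%:E * dVint alpha (Qdyadic r) h <=
   (kappa / (1 - 2 * volr))%:E * dVint alpha Hplane h)%E.
  apply: lee_wpmul2l; first by rewrite lee_fin.
  by apply: dVint_subset => //; [exact: measurable_Qdyadic|exact: measurable_Hplane|exact: Qdyadic_Hplane].
rewrite EFinD ge0_muleDl ?lee_fin//; exact: leeD.
Qed.

End tree.
End dyadic.

(** * Covering by overlapping dyadic boxes *)

Section wide.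
Variable R : realType.
Implicit Types (x : int * int).

Lemma dyadic_scale (l : R) : 0 < l -> exists k : int, 2 ^ (k - 1) <= l < 2 ^ k.
Proof.
move=> l0; pose t := ln l / ln 2.
have ln2 : 0 < ln 2 :> R by rewrite ln_gt0// ltr1n.
have lE : l = 2 `^ t.
  by rewrite /powR pnatr_eq0 /= /t divfK ?gt_eqF// lnK// posrE.
exists (Num.floor t + 1); rewrite addrK -!powR_intmul// lE.
apply/andP; split.
  by rewrite ler_powR ?ler1n// ge_floor.
have tlt : t < (Num.floor t + 1)%:~R by exact: floorD1_gt.
by rewrite /powR pnatr_eq0 /= ltr_expR ltr_pM2r.
Qed.

(** The boxes over the intervals J of the overview. Their length is twice the step 2^k, and this
    overlap lets every interval fit into one of comparable length. *)
Definition Qwide x : set (R * R) :=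
  Qbox (x.2%:~R * 2 ^ x.1) ((x.2 + 2)%:~R * 2 ^ x.1) true true.

(** Take 2^(k-1) <= b - a < 2^k and m the floor of a / 2^k; then b < a + 2^k < (m + 2) 2^k. The
    factor 4 is 2^(k+1) / 2^(k-1). *)
Lemma Qwide_cover (a b : R) ba bb : a < b ->
  exists x, Qbox a b ba bb `<=` Qwide x /\ 2 ^ (x.1 + 1) <= 4 * (b - a).
Proof.
move=> ab; have l0 : 0 < b - a by rewrite subr_gt0.
have [k /andP[k1 k2]] := dyadic_scale l0.
have e0 : 0 < 2 ^ k :> R by rewrite exprz_gt0.
pose m := Num.floor (a / 2 ^ k).
have m1 : m%:~R * 2 ^ k <= a by rewrite -ler_pdivlMr// ge_floor.
have m2 : a < (m + 1)%:~R * 2 ^ k.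
  by rewrite -ltr_pdivrMr// floorD1_gt.
have E1 : 2 ^ k = 2 * 2 ^ (k - 1) :> R := exp2_pred R k.
have E2 : 2 ^ (k + 1) = 2 * 2 ^ k :> R by rewrite (exp2_pred R (k + 1)) addrK.
exists (k, m); split; last by rewrite /= E2 E1; lra.
move: m2; rewrite intrD mulrDl mul1r => m2.
move=> [u v]; rewrite /Qwide QboxE /= => -[/= uI /andP[v0 vl]].
have [au ub] : a <= u /\ u <= b.
  move: uI; rewrite /itv /=; case: ba; case: bb; rewrite in_itv/= => /andP[]; lra.
rewrite intrD; split; apply/andP; split => //; lra.
Qed.

(** A wide interval has length 2^(x.1 + 1) and lies in the union of two consecutive dyadic intervals
    of that same length; these are their codes. *)
Definition left_cover x : int * int := (x.1 + 1, (x.2 %/ 2)%Z).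
Definition right_cover x : int * int := (x.1 + 1, (x.2 %/ 2)%Z + 1).

(** Floor quotient by 2 and parity determine an integer, so for a fixed side and parity a dyadic box
    covers only one wide box. *)
Lemma cover_inj (b : bool) u w : ((u.2 %% 2)%Z == 0) = ((w.2 %% 2)%Z == 0) ->
  (if b then left_cover u else right_cover u) =
  (if b then left_cover w else right_cover w) -> u = w.
Proof.
case: u w => [u1 u2] [w1 w2] /= pE e.
have [e1 e2] : u1 + 1 = w1 + 1 /\ (u2 %/ 2)%Z = (w2 %/ 2)%Z.
  by case: b e => -[e1 e2]; split; move: e1 e2; clear; lia.
apply/eqP; rewrite xpair_eqE; move: pE e1 e2; clear; lia.
Qed.

Lemma Qwide_dyadic x :
  Qwide x `<=` Qdyadic (left_cover x) `|` Qdyadic (right_cover x).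
Proof.
have E2 : 2 ^ (x.1 + 1) = 2 * 2 ^ x.1 :> R by rewrite (exp2_pred R (x.1 + 1)) addrK.
have e0 : 0 < 2 ^ x.1 :> R by rewrite exprz_gt0.
have [m1 m2] : (2 * (x.2 %/ 2)%Z)%:~R <= x.2%:~R :> R /\
    x.2%:~R <= (2 * (x.2 %/ 2)%Z + 1)%:~R :> R.
  by rewrite !ler_int; lia.
move: m1 m2; rewrite !(intrD, intrM) => m1 m2.
move=> [u v]; rewrite /setU /Qwide /Qdyadic /= !QboxE /= E2 => -[/andP[u1 u2] /andP[v1 v2]].
move: u1 u2 v2; rewrite !(intrD, intrM).
move: m1 m2; move: ((x.2 %/ 2)%Z%:~R) (x.2%:~R) (2 ^ x.1) e0 => q n e e0 m1 m2 u1 u2 v2.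
have q1 : 2 * q * e <= n * e by rewrite ler_pM2r.
have q2 : n * e <= (2 * q + 1) * e by rewrite ler_pM2r.
have [uq|uq] := ltP u ((q + 1) * (2 * e)); [left|right]; split; apply/andP; split => //; lra.
Qed.

Variable alpha : R.
Hypothesis alpha1 : -1 < alpha.
Local Notation Vol := (Vol alpha).

Lemma volQ_wide x :
  volQ alpha (x.2%:~R * 2 ^ x.1) ((x.2 + 2)%:~R * 2 ^ x.1) true true = (Vol (x.1 + 1))%:E.
Proof.
have e0 : 0 < 2 ^ x.1 :> R by rewrite exprz_gt0.
have E2 : 2 ^ (x.1 + 1) = 2 * 2 ^ x.1 :> R by rewrite (exp2_pred R (x.1 + 1)) addrK.
rewrite volQE//; first by rewrite intrD -mulrBl addrAC subrr add0r -E2.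
by rewrite ltr_pM2r// ltr_int; lia.
Qed.

Variable h : R * R -> \bar R.
Hypothesis mh : measurable_fun Hplane h.
Hypothesis h0 : forall z, Hplane z -> (0 <= h z)%E.

(** One of the two dyadic covers of a wide box carries at least half of the required mass; [phi]
    selects it, which gives the hypothesis of [dyadic_sum_le] with [kappa] equal to 2. *)
Lemma Qwide_weak_type (s : seq (int * int)) : uniq s ->
  (forall x, x \in s -> ((Vol (x.1 + 1))%:E <= dVint alpha (Qwide x) h)%E) ->
  ((\sum_(x <- s) Vol (x.1 + 1))%:E <=
   (16 / (1 - 2 * volr alpha))%:E * dVint alpha Hplane h)%E.
Proof.
move=> us Ps.
have c0 := volr_lt alpha1.
pose good x : bool := `[< ((Vol (x.1 + 1))%:E <=
  2%:E * dVint alpha (Qdyadic (left_cover x)) h)%E >].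
pose phi x := if good x then left_cover x else right_cover x.
pose par (w : int * int) := (w.2 %% 2)%Z == 0.
have I0 A : A `<=` Hplane -> (0 <= dVint alpha A h)%E.
  by move=> AH; apply: dVint_ge0 => z /AH; exact: h0.
have mhS A : A `<=` Hplane -> measurable_fun A h.
  by move=> AH; apply: measurable_funS mh => //; exact: measurable_Hplane.
have Pphi x : x \in s ->
    ((Vol (phi x).1)%:E <= 2%:E * dVint alpha (Qdyadic (phi x)) h)%E.
  move=> xs; rewrite /phi; case: (boolP (good x)) => /= [/asboolP|].
    by [].
  move=> /asboolP/negP; rewrite -ltNge => g1.
  have P1 := Ps _ xs.
  have /= D1 := @Qdyadic_Hplane R (left_cover x).
  have /= D2 := @Qdyadic_Hplane R (right_cover x).
  have P2 : ((Vol (x.1 + 1))%:E <= dVint alpha (Qdyadic (left_cover x)) h +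
     dVint alpha (Qdyadic (right_cover x)) h)%E.
    apply: (le_trans P1).
    have DU : Qdyadic (left_cover x) `|` Qdyadic (right_cover x) `<=` @Hplane R.
      by move=> z [/D1|/D2].
    rewrite -dVint_setU; [|exact: measurable_Qdyadic|exact: measurable_Qdyadic|exact: mhS| by move=> z /DU; exact: h0|].
      apply: dVint_subset; [exact: measurable_Qbox| | exact: mhS|by move=> z /DU; exact: h0|exact: Qwide_dyadic].
      by apply: measurableU; exact: measurable_Qdyadic.
    apply/disj_setPLR => -[u v]; rewrite /Qdyadic/= !QboxE/=.
    by move=> [/andP[_ u1] _] [/andP[+ _] _]; rewrite leNgt u1.
  have tw0 : (0 < 2%:E :> \bar R)%E by rewrite lte_fin.
  move: g1 P2 (I0 _ D1) (I0 _ D2).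
  case: (dVint _ _ _) => [A| |]; [|by rewrite gt0_muley|by []].
  case: (dVint _ _ _) => [B| |//]; last by rewrite gt0_muley// leey.
  by rewrite -!EFinM -EFinD lte_fin !lee_fin; lra.
(* On a class where the selected side and the parity are constant, [phi] is injective by
   [cover_inj], so the selected dyadic boxes form a duplicate-free list. *)
have main (c : pred (int * int)) :
   {in [seq x <- s | c x] &, forall x y, good x = good y /\ par x = par y} ->
   ((\sum_(x <- s | c x) Vol (x.1 + 1))%:E <=
     (4 / (1 - 2 * volr alpha))%:E * dVint alpha Hplane h)%E.
  move=> cP; rewrite -big_filter.
  have inj : {in [seq x <- s | c x] &, injective phi}.
    move=> u w us' ws; have [gE pE] := cP _ _ us' ws.
    by rewrite /phi gE; exact: cover_inj pE.
  rewrite (eq_bigr (fun w => Vol (phi w).1)); last by move=> w _; rewrite /phi; case: ifP.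
  have := @dyadic_sum_le R alpha alpha1 (map phi [seq x <- s | c x]) _ h 2 mh h0 _ _.
  rewrite big_map /= (_ : 2 * 2 = 4 :> R); last by lra.
  apply; rewrite ?map_inj_in_uniq ?filter_uniq//.
  by move=> y /mapP[u]; rewrite mem_filter => /andP[_ us'] ->; exact: Pphi.
rewrite (bigID good)/= (bigID par)/= [X in _ + X](bigID par)/= !EFinD.
have C0 : (0%:E <= (4 / (1 - 2 * volr alpha))%:E)%E by rewrite lee_fin divr_ge0// ltW.
(* Side and parity give four classes, each contributing 2 kappa = 4. *)
have -> : 16 / (1 - 2 * volr alpha) = 4 / (1 - 2 * volr alpha) + 4 / (1 - 2 * volr alpha)
   + (4 / (1 - 2 * volr alpha) + 4 / (1 - 2 * volr alpha)).
  by field; rewrite gt_eqF.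
rewrite !EFinD !ge0_muleDl ?adde_ge0//.
apply: leeD; apply: leeD; apply: main => u w; rewrite !mem_filter => /= /andP[/andP[g1 p1] _] /andP[/andP[g2 p2] _];
 by split; move: g1 g2 p1 p2; case: (good u); case: (good w); case: (par u); case: (par w).
Qed.

End wide.

(** * Dyadic form of the B_p condition *)

Lemma uniq_sum_le (R : realType) (b : nat -> R) (s : seq nat) :
  (forall n, 0 <= b n) -> uniq s -> exists N, \sum_(n <- s) b n <= \sum_(n < N) b n.
Proof.
move=> b0 us; pose N := (\sum_(n <- s) n).+1; exists N.
rewrite -(big_mkord xpredT b) /index_iota subn0.
have ps : perm_eq s [seq n <- iota 0 N | n \in s].
  apply: uniq_perm => //; first by rewrite filter_uniq// iota_uniq.
  move=> n; rewrite mem_filter mem_iota/= add0n; have [ns|//] := boolP (n \in s).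
  by rewrite /N ltnS (big_rem n)//= leq_addr.
rewrite (perm_big _ ps) big_filter [leRHS](bigID (mem s))/= lerDl.
by apply: sumr_ge0.
Qed.

Lemma absz_subl_inj (k i j : int) : i < k -> j < k ->
  `|k - i|%N = `|k - j|%N -> i = j.
Proof. lia. Qed.

Section Bp.
Variables (R : realType) (p : R) (Phi : R -> R).
Hypotheses (p1 : 1 < p) (YPhi : Young Phi) (BPhi : Bp p Phi).

Let p_ge0 : 0 <= p. Proof. exact: ltW (lt_trans ltr01 p1). Qed.

Lemma Young_ge0 t : 0 <= t -> 0 <= Phi t.
Proof. by have [_ _ _ + _] := YPhi; exact. Qed.

Lemma Young_le x y : 0 <= x -> x <= y -> Phi x <= Phi y.
Proof.
move=> x0; rewrite le_eqVlt => /orP[/eqP->//|xy].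
by have [_ _ + _ _] := YPhi => /(_ x y x0 xy)/ltW.
Qed.

(** [Phi] is increasing on the nonnegative half-line only; composed with the positive part it is
    monotone on the whole line, hence measurable. *)
Lemma measurable_Young : measurable_fun setT (fun t : R => Phi (Num.max 0 t)).
Proof.
apply: nondecreasing_measurable => // x y xy; apply: Young_le.
  by rewrite le_max lexx.
by rewrite ge_max !le_max lexx/= xy orbT.
Qed.

Let F t := (Phi t / t `^ p) / t.

Lemma measurable_Bp_integrand (c : R) : 0 < c -> measurable_fun `[c, +oo[ F.
Proof.
move=> c0.
apply: (@eq_measurable_fun _ _ _ _ _ (fun t : R => Phi (Num.max 0 t) * t `^ (- p) * t `^ (- 1))).
  move=> t; rewrite inE/= in_itv/= andbT => ct.
  have t0 : 0 <= t by apply: le_trans ct; exact: ltW.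
  by rewrite powR_inv1// powRN max_r.
apply: measurable_funTS; apply: measurable_funM; last exact: measurable_powR.
by apply: measurable_funM; [exact: measurable_Young|exact: measurable_powR].
Qed.

Definition dyadic_coef (n : nat) : R := Phi (2 ^+ n) / (2 ^+ n) `^ p.

Lemma dyadic_coef_ge0 n : 0 <= dyadic_coef n.
Proof. by rewrite /dyadic_coef divr_ge0 ?powR_ge0// Young_ge0// exprn_ge0. Qed.

(** On [2^n, 2^(n+1)) the numerator is at least its value at the left end and the denominators at
    most theirs at the right end. Passing from one end to the other costs 2^(p+1). *)
Lemma dyadic_coef_le_integral (c : R) n : 0 < c -> c <= 2 ^+ n ->
  ((dyadic_coef n)%:E <= (2 `^ (p + 1))%:E *
    \int[@lebesgue_measure R]_(t in `[(2 ^+ n)%R, (2 ^+ n.+1)%R[) (F t)%:E)%E.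
Proof.
move=> c0 cn.
have n0 : 0 < 2 ^+ n :> R by rewrite exprn_gt0.
pose K := (Phi (2 ^+ n) / (2 ^+ n.+1) `^ p) / 2 ^+ n.+1.
have K0 : 0 <= K.
  by rewrite /K !divr_ge0 ?powR_ge0 ?exprn_ge0// Young_ge0// exprn_ge0.
have -> : dyadic_coef n = 2 `^ (p + 1) * (K * (2 ^+ n.+1 - 2 ^+ n)).
  rewrite /dyadic_coef /K exprS powRM// ?exprn_ge0// powRD ?pnatr_eq0 ?implybT//.
  rewrite powRr1//.
  field; rewrite ?gt_eqF ?powR_gt0//.
rewrite EFinM lee_wpmul2l ?lee_fin ?powR_ge0//.
have -> : (K * (2 ^+ n.+1 - 2 ^+ n))%:E =
    (\int[@lebesgue_measure R]_(t in `[(2 ^+ n)%R, (2 ^+ n.+1)%R[) K%:E)%E.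
  rewrite integral_cst//=.
  by rewrite lebesgue_measure_itv/= lte_fin exprS ltr_pMl// ltr1n.
apply: ge0_le_integral => //=.
- apply/measurable_EFinP; apply: measurable_funS (measurable_Bp_integrand c0) => //.
  by move=> t /=; rewrite !in_itv/= andbT => /andP[/(le_trans cn)].
- move=> t; rewrite in_itv/= => /andP[t1 t2].
  have t0 := lt_le_trans n0 t1.
  have n10 : 0 < 2 ^+ n.+1 :> R by rewrite exprn_gt0.
  rewrite lee_fin /K /F; apply: ler_pM.
  + by rewrite !divr_ge0 ?powR_ge0// Young_ge0// ltW.
  + by rewrite invr_ge0 ltW.
  + apply: ler_pM; rewrite ?invr_ge0 ?powR_ge0 ?Young_ge0 ?(ltW n0)//.
      by apply: Young_le => //; exact: ltW.
    rewrite lef_pV2 ?posrE ?powR_gt0//.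
    apply: ge0_ler_powR; rewrite ?nnegrE ?(ltW t0) ?(ltW n10) ?(ltW t2)//.
  + by rewrite lef_pV2 ?posrE// ltW.
Qed.

(** The integral in the B_p condition controls only the indices with 2^n >= c; the first [N0] terms
    enter [D] as they stand, and the remaining ones are compared with the integral over adjacent
    dyadic blocks. *)
Lemma dyadic_coef_bounded : exists2 D, 0 <= D & forall N, \sum_(n < N) dyadic_coef n <= D.
Proof.
have [_ [c [c0 Ic]]] := BPhi.
have [N0 cN0] : exists N0 : nat, c <= 2 ^+ N0.
  exists (Num.truncn c).+1; apply: ltW; apply: lt_trans (truncnS_gt _) _.
  by rewrite -natrX ltr_nat ltn_expl.
have F0 t : c <= t -> (0 <= (F t)%:E)%E.
  move=> ct; have t0 : 0 <= t by apply: le_trans ct; exact: ltW.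
  by rewrite lee_fin /F !divr_ge0 ?powR_ge0// Young_ge0.
have mF (A : set R) : A `<=` `[c, +oo[ -> measurable_fun A (fun t => (F t)%:E).
  move=> AH; apply/measurable_EFinP; apply: measurable_funS (measurable_Bp_integrand c0) => //.
have pow_mono (n m : nat) : (n <= m)%N -> 2 ^+ n <= 2 ^+ m :> R.
  by move=> nm; rewrite ler_weXn2l ?ler1n.
have sub (a b : R) : c <= a -> `[a, b[ `<=` `[c, +oo[.
  by move=> ca t /=; rewrite !in_itv/= andbT => /andP[/(le_trans ca)].
have claim M : ((\sum_(i < M) dyadic_coef (N0 + i))%:E <= (2 `^ (p + 1))%:E *
    \int[@lebesgue_measure R]_(t in `[(2 ^+ N0)%R, (2 ^+ (N0 + M))%R[) (F t)%:E)%E.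
  elim: M => [|M IH].
    by rewrite big_ord0 mule_ge0 ?lee_fin ?powR_ge0// integral_ge0// => t /(sub _ _ cN0)/=;
       rewrite in_itv/= andbT => /F0.
  rewrite big_ord_recr/= EFinD.
  have cM : c <= 2 ^+ (N0 + M) by apply: le_trans cN0 _; apply: pow_mono; rewrite leq_addr.
  apply: le_trans (leeD IH (dyadic_coef_le_integral c0 cM)) _.
  have I0 (a b : R) : c <= a -> (0 <= \int[@lebesgue_measure R]_(t in `[a, b[) (F t)%:E)%E.
    by move=> ca; rewrite integral_ge0// => t /(sub _ _ ca)/=; rewrite in_itv/= andbT => /F0.
  rewrite -ge0_muleDr ?I0// lee_wpmul2l ?lee_fin ?powR_ge0//.
  rewrite -ge0_integral_setU//=.
  - rewrite addnS le_eqVlt; apply/orP; left; apply/eqP; congr integral.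
    apply/seteqP; split => t /=; rewrite !in_itv/=.
      have l1 : 2 ^+ N0 <= 2 ^+ (N0 + M) :> R by apply: pow_mono; rewrite leq_addr.
      have l2 : 2 ^+ (N0 + M) <= 2 ^+ (N0 + M).+1 :> R by apply: pow_mono.
      by move=> [|] /andP[h1 h2]; apply/andP; split; lra.
    by move=> /andP[h1 h2]; have [h3|h3] := ltP t (2 ^+ (N0 + M)); [left|right]; apply/andP.
  - by apply: mF => t [] /sub; exact.
  - by move=> t [] /sub -/(_ _)/= H; apply: F0; [have := H cN0|have := H cM]; rewrite in_itv/= andbT.
  - apply/disj_setPLR => t /=; rewrite !in_itv/= => /andP[_ h1] /andP[h2 _].
    by move: h1; rewrite ltNge h2.
pose I := (\int[@lebesgue_measure R]_(t in `[c, +oo[) (F t)%:E)%E.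
have I0 : (0 <= I)%E.
  by apply: integral_ge0 => t /=; rewrite in_itv/= andbT => /F0.
have fI : I \is a fin_num by rewrite ge0_fin_numE.
pose D := \sum_(n < N0) dyadic_coef n + 2 `^ (p + 1) * fine I.
exists D.
  rewrite /D addr_ge0 ?mulr_ge0 ?powR_ge0 ?fine_ge0//.
  by apply: sumr_ge0 => n _; exact: dyadic_coef_ge0.
move=> N.
have : \sum_(n < N0 + N) dyadic_coef n <= D.
  rewrite big_split_ord/= lerD2l -lee_fin EFinM fineK//.
  apply: le_trans (claim N) _.
  rewrite lee_wpmul2l ?lee_fin ?powR_ge0//.
  apply: ge0_subset_integral => //=.
  - exact: mF.
  - by move=> t; rewrite in_itv/= andbT => /F0.
  - exact: sub.
apply: le_trans; rewrite addnC big_split_ord/= lerDl.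
by apply: sumr_ge0 => n _; exact: dyadic_coef_ge0.
Qed.

(** The S_j of the overview as a function of the value of g. The cut-off confines the sum over j to
    the levels with 2^j < g. *)
Definition Phi_above (j : int) (g : R) : R := if 2 ^ j < g then Phi (g / 2 ^ j) else 0.

Lemma Phi_above_ge0 j g : 0 <= Phi_above j g.
Proof.
rewrite /Phi_above; case: ifP => // /ltW jg; apply: Young_ge0.
have j0 : 0 < 2 ^ j :> R by rewrite exprz_gt0.
by rewrite divr_ge0// ?(le_trans _ jg)// ltW.
Qed.

(** Where the cut-off acts, g / 2^j is at most 1, so it costs at most [Phi 1]. *)
Lemma Phi_le_above j g : 0 <= g -> Phi (g / 2 ^ j) <= Phi 1 + Phi_above j g.
Proof.
move=> g0; have j0 : 0 < 2 ^ j :> R by rewrite exprz_gt0.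
rewrite /Phi_above; case: ltP => jg; first by rewrite lerDr Young_ge0.
by rewrite addr0; apply: Young_le; rewrite ?divr_ge0 ?(ltW j0)// ler_pdivrMr// mul1r.
Qed.

(** With 2^(k-1) <= g < 2^k only levels j < k contribute. For n = k - j the term is at most 2^(k p)
    [dyadic_coef n] <= (2 g)^p [dyadic_coef n], and distinct j give distinct n. *)
Lemma sum_Phi_above : exists2 D, 0 <= D & forall g, 0 <= g ->
  forall js : seq int, uniq js ->
    \sum_(j <- js) (2 ^ j) `^ p * Phi_above j g <= D * g `^ p.
Proof.
have [D D0 DP] := dyadic_coef_bounded.
exists (2 `^ p * D); first by rewrite mulr_ge0// powR_ge0.
move=> g; rewrite le_eqVlt => /orP[/eqP <-|g0] js ujs.
  rewrite big1 ?mulr_ge0 ?powR_ge0// => j _.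
  by rewrite /Phi_above ltNge ltW ?exprz_gt0// mulr0.
have [k /andP[k1 k2]] := dyadic_scale g0.
rewrite (bigID (fun j : int => (j < k))) /= [X in _ + X]big1 ?addr0; last first.
  move=> j; rewrite -leNgt => kj.
  rewrite /Phi_above ltNge (le_trans (ltW k2)) ?mulr0//.
  by rewrite ler_weXz2l ?ler1n.
have E (j : int) : j < k -> (2 ^ j) `^ p * Phi_above j g <= (2 `^ p * g `^ p) * dyadic_coef `|k - j|%N.
  move=> jk.
  have kE : 2 ^ k = 2 ^ j * 2 ^+ `|k - j|%N :> R.
    by rewrite exprnP -expfzDr ?pnatr_eq0//; congr (_ ^ _); lia.
  have j0 : 0 < 2 ^ j :> R by rewrite exprz_gt0.
  have g2 : 2 ^ k <= 2 * g by rewrite (exp2_pred R k); lra.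
  set n := `|k - j|%N in kE *.
  have n0 : 0 < 2 ^+ n :> R by rewrite exprn_gt0.
  have P1 : Phi_above j g <= Phi (2 ^+ n).
    rewrite /Phi_above; case: ifP => _; last by rewrite Young_ge0 ?ltW.
    by apply: Young_le; [rewrite divr_ge0 ?ltW|rewrite ler_pdivrMr// mulrC -kE ltW].
  apply: (@le_trans _ _ ((2 ^ j) `^ p * Phi (2 ^+ n))).
    by rewrite ler_wpM2l ?powR_ge0.
  rewrite -powRM ?(ltW g0)//.
  apply: (@le_trans _ _ ((2 ^ k) `^ p * dyadic_coef n)); last first.
    rewrite ler_wpM2r ?dyadic_coef_ge0//.
    by apply: ge0_ler_powR; rewrite ?nnegrE ?mulr_ge0 ?(ltW g0) ?exprz_ge0.
  rewrite kE powRM ?(ltW j0) ?(ltW n0)// /dyadic_coef le_eqVlt; apply/orP; left; apply/eqP.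
  by field; rewrite gt_eqF// powR_gt0.
apply: (le_trans (ler_sum _ (E))).
rewrite -mulr_sumr [leLHS]mulrAC.
rewrite ler_pM2r ?powR_gt0// ler_pM2l ?powR_gt0//.
rewrite -big_filter -(big_map (fun j : int => `|k - j|%N) xpredT dyadic_coef).
have [|N HN] := uniq_sum_le dyadic_coef_ge0 (_ : uniq [seq `|k - j|%N | j <- js & j < k]).
  rewrite map_inj_in_uniq ?filter_uniq//.
  move=> i j; rewrite !mem_filter => /andP[ik _] /andP[jk _].
  exact: absz_subl_inj ik jk.
exact: le_trans HN (DP N).
Qed.

End Bp.

(** * Complementary functions *)

(* No measurability: nonnegative integrals are suprema over simple minorants. *)
Lemma ge0_le_integral_nonmeas d (T : measurableType d) (R : realType)
    (mu : {measure set T -> \bar R}) (D : set T) (f g : T -> \bar R) :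
  (forall x, D x -> 0 <= f x)%E -> (forall x, D x -> f x <= g x)%E ->
  (\int[mu]_(x in D) f x <= \int[mu]_(x in D) g x)%E.
Proof.
move=> f0 fg.
have fD0 x : (0 <= (f \_ D) x)%E.
  by rewrite patchE; case: ifPn => // /[!inE]; exact: f0.
have fgD x : ((f \_ D) x <= (g \_ D) x)%E.
  by rewrite !patchE; case: ifPn => // /[!inE]; exact: fg.
rewrite !(integral_mkcond D) !ge0_integralTE//; last by move=> x; exact: le_trans (fgD x).
apply: ge_ereal_sup => _ [h hf <-]; apply: ereal_sup_ubound.
by exists h => // x; exact: le_trans (fgD x).
Qed.

Lemma int_transition (P : int -> Prop) (j0 : int) (n : nat) :
  P j0 -> ~ P (j0 + n%:Z) -> exists j, P j /\ ~ P (j + 1).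
Proof.
move=> P0 Pn; apply: contrapT => H; apply: Pn.
elim: n => [|n IH]; first by rewrite addr0.
rewrite -addn1 PoszD addrA; apply: contrapT => Pn1.
by apply: H; exists (j0 + n%:Z).
Qed.

Section complementary.
Variables (R : realType) (Phi : R -> R).
Hypothesis YPhi : Young Phi.

Lemma compl_ge0 s : (0 <= compl Phi s)%E.
Proof.
apply: ereal_sup_ubound; exists 0; first by rewrite /= in_itv/= lexx.
by have [[_ ->] _ _ _ _] := YPhi; rewrite mul0r subrr.
Qed.

Lemma le_compl s t : s <= t -> (compl Phi s <= compl Phi t)%E.
Proof.
move=> st; apply: ge_ereal_sup => _ [x x0 <-].
have /= x0' : 0 <= x by move: x0; rewrite /= in_itv/= andbT.
apply: (@le_trans _ _ (x * t - Phi x)%:E); first by rewrite lee_fin lerB// ler_wpM2l.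
by apply: ereal_sup_ubound; exists x.
Qed.

Lemma Young_inequality s t : 0 <= t ->
  ((t * s)%:E <= (Phi t)%:E + compl Phi s)%E.
Proof.
move=> t0; have : ((t * s - Phi t)%:E <= compl Phi s)%E.
  by apply: ereal_sup_ubound; exists t => //=; rewrite in_itv/= t0.
by rewrite EFinB leeBlDl.
Qed.

(** [compl Phi] is monotone, possibly with the value +oo, so its superlevel sets are intervals. *)
Lemma measurable_compl : measurable_fun setT (compl Phi).
Proof.
apply: (measurability _ (ErealGenOInfty.measurableE R)) => //.
move=> _ [_ [x ->] <-]; apply: measurableI => //.
apply: is_interval_measurable => s t/=.
rewrite !in_itv/= !andbT => xs xt u /andP[su ut].
by rewrite in_itv/= andbT (lt_le_trans xs)// le_compl.
Qed.

Lemma measurable_extE_winv (omega : R * R -> R) (sigma : R) A :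
  measurable_fun Hplane omega -> (forall z, Hplane z -> 0 <= omega z) ->
  0 < sigma -> measurable A -> A `<=` Hplane ->
  measurable_fun A (fun z => extE (compl Phi) (winv omega z * (sigma^-1)%:E)).
Proof.
move=> mo o0 s0 mA AH.
(* The integrand as a function of the value of [omega] alone, with the value +oo at 0 made
   explicit. *)
pose G (r : R) : \bar R := if r == 0 then +oo%E else compl Phi (r `^ (- 1) * sigma^-1).
have mG : measurable_fun setT G.
  apply: measurable_fun_ifT => //.
    apply: (measurable_fun_bool true).
    rewrite (_ : _ @^-1` _ = [set 0]) ?setTI//.
    by apply/seteqP; split => [_ /eqP ->//|_ -> /=]; rewrite eqxx.
  apply: measurableT_comp; first exact: measurable_compl.
  by apply: measurable_funM => //; exact: measurable_powR.
apply: (@eq_measurable_fun _ _ _ _ _ (G \o omega)).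
  move=> z /[!inE] /AH/o0 oz; rewrite /G /winv /=; case: eqP => _ /=.
    by rewrite gt0_mulye// lte_fin invr_gt0.
  by rewrite powR_inv1.
apply: measurableT_comp => //; apply: measurable_funS mo => //.
exact: measurable_Hplane.
Qed.

Lemma extE_compl_ge0 (x : \bar R) : (0 <= extE (compl Phi) x)%E.
Proof. by case: x => [r| |] //=; exact: compl_ge0. Qed.

End complementary.

(** * Averages over one box *)

Section one_box.
Variables (R : realType) (alpha : R) (Phi : R -> R) (omega f : R * R -> R).
Hypotheses (alpha1 : -1 < alpha) (YPhi : Young Phi).
Hypotheses (mo : measurable_fun Hplane omega) (o0 : forall z, Hplane z -> 0 <= omega z).
Hypothesis mf : measurable_fun Hplane f.

Definition Phi_level (j : int) (z : R * R) : \bar R :=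
  (Phi_above Phi j `|f z * omega z|)%:E.

Lemma measurable_norm_fw : measurable_fun Hplane (fun z => `|f z * omega z|).
Proof. by apply: measurableT_comp => //; exact: measurable_funM. Qed.

Lemma measurable_Phi_level j : measurable_fun Hplane (Phi_level j).
Proof.
apply/measurable_EFinP.
pose h (r : R) := if 2 ^ j < r then Phi (Num.max 0 (r / 2 ^ j)) else 0.
have mh : measurable_fun setT h.
  apply: measurable_fun_ifT => //; first exact: measurable_fun_ltr.
  apply: (measurableT_comp (measurable_Young YPhi)).
  by apply: measurable_funM.
apply: (@eq_measurable_fun _ _ _ _ _ (h \o (fun z => `|f z * omega z|))).
  move=> z _; rewrite /h /Phi_above /=; case: ifP => // _.
  by rewrite max_r// divr_ge0// exprz_ge0.
by apply: measurableT_comp => //; exact: measurable_norm_fw.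
Qed.

Lemma Phi_level_ge0 j z : (0 <= Phi_level j z)%E.
Proof. by rewrite lee_fin Phi_above_ge0. Qed.

(* Young's inequality applied to [|f| / (lam * sigma) = (|f omega| / lam) * (omega^-1 / sigma)]. *)
Lemma norm_le_Young j sigma z : 0 < sigma -> Hplane z ->
  ((`|f z|)%:E <= (2 ^ j * sigma)%:E *
    ((Phi 1)%:E + Phi_level j z +
     extE (compl Phi) (winv omega z * (sigma^-1)%:E)))%E.
Proof.
move=> s0 Hz; have oz := o0 Hz.
have j0 : 0 < 2 ^ j :> R by rewrite exprz_gt0.
have P1 : 0 <= Phi 1 by apply: Young_ge0.
have c0 : 0 < 2 ^ j * sigma by rewrite mulr_gt0.
(* Where [omega] vanishes, [winv] is +oo and so is the right-hand side. *)
rewrite /winv; case: eqP => [_|/eqP oz0].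
  rewrite gt0_mulye ?lte_fin ?invr_gt0//= /Phi_level -EFinD.
  by rewrite addey// gt0_muley ?lte_fin// leey.
have ogt : 0 < omega z by rewrite lt_neqAle eq_sym oz0.
have g0 : 0 <= `|f z * omega z| / 2 ^ j by rewrite divr_ge0// ltW.
have YI := Young_inequality Phi ((omega z)^-1 * sigma^-1) g0.
rewrite /= /Phi_level -EFinD.
have -> : (`|f z|)%:E = ((2 ^ j * sigma)%:E *
   (`|f z * omega z| / 2 ^ j * ((omega z)^-1 * sigma^-1))%:E)%E.
  rewrite -EFinM; congr (_ %:E); rewrite normrM (ger0_norm oz); field.
  by rewrite !gt_eqF.
rewrite lee_wpmul2l ?lee_fin ?(ltW c0)//.
apply: (le_trans YI); rewrite leeD2r// lee_fin.
exact: Phi_le_above.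
Qed.

Local Notation Vol := (Vol alpha).
Local Notation lux x := (luxemburg alpha (compl Phi) (winv omega)
  (x.2%:~R * 2 ^ x.1) ((x.2 + 2)%:~R * 2 ^ x.1) true true).

(** Integrate [norm_le_Young]: the constant contributes [Phi 1] times the volume, while the level
    function and the complementary term contribute at most one volume each. *)
Lemma dVint_norm_le_lux_adm j sigma (x : int * int) : 0 < sigma ->
  ((Vol (x.1 + 1))^-1%:E *
    dVint alpha (Qwide x) (fun z => extE (compl Phi) (winv omega z * (sigma^-1)%:E)) <= 1)%E ->
  (dVint alpha (Qwide x) (Phi_level j) <= (Vol (x.1 + 1))%:E)%E ->
  (dVint alpha (Qwide x) (fun z => (`|f z|)%:E) <=
   (sigma * (2 ^ j * (Phi 1 + 2) * Vol (x.1 + 1)))%:E)%E.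
Proof.
move=> s0 Hs HX.
have V0 := Vol_gt0 alpha1 (x.1 + 1).
have mQ : measurable (@Qwide R x) by exact: measurable_Qbox.
have QH : @Qwide R x `<=` Hplane by exact: Qbox_Hplane.
have j0 : 0 < 2 ^ j :> R by rewrite exprz_gt0.
have P1 : 0 <= Phi 1 by apply: Young_ge0.
have c0 : 0 < 2 ^ j * sigma by rewrite mulr_gt0.
have mE := measurable_extE_winv Phi mo o0 s0 mQ QH.
have mP : measurable_fun (Qwide x) (Phi_level j).
  by apply: measurable_funS (measurable_Phi_level j) => //; exact: measurable_Hplane.
have mf' : measurable_fun (Qwide x) (fun z => (`|f z|)%:E).
  apply/measurable_EFinP; apply: measurableT_comp => //.
  by apply: measurable_funS mf => //; exact: measurable_Hplane.
set E := fun z => extE _ _ in Hs mE.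
have E0 z : (0 <= E z)%E by exact: extE_compl_ge0.
have mS : measurable_fun (Qwide x) (fun z => (Phi 1)%:E + Phi_level j z)%E.
  by apply: emeasurable_funD.
have S0 z : (0 <= (Phi 1)%:E + Phi_level j z)%E.
  by rewrite adde_ge0// Phi_level_ge0.
apply: (@le_trans _ _ ((2 ^ j * sigma)%:E * dVint alpha (Qwide x)
   (fun z => (Phi 1)%:E + Phi_level j z + E z))%E).
  rewrite -dVintZl ?(ltW c0)//.
  - apply: le_dVint => //.
    + apply: emeasurable_funM => //; exact: emeasurable_funD.
    + by move=> z /QH; exact: norm_le_Young.
  - exact: emeasurable_funD.
  - by move=> z _; rewrite adde_ge0.
rewrite dVintD// dVintD//; last by move=> z _; exact: Phi_level_ge0.
rewrite dVint_cst//.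
have -> : dVint alpha (Qwide x) (fun=> 1%E) = (Vol (x.1 + 1))%:E by rewrite -(volQ_wide alpha1).
have HE : (dVint alpha (Qwide x) E <= (Vol (x.1 + 1))%:E)%E.
  by move: Hs; rewrite lee_pdivrMl// mule1.
rewrite [X in (_ <= X)%E](_ : _ = (2 ^ j * sigma)%:E *
   ((Phi 1)%:E * (Vol (x.1 + 1))%:E + (Vol (x.1 + 1))%:E + (Vol (x.1 + 1))%:E))%E; last first.
  by rewrite -!EFinM; congr (_ %:E); ring.
by rewrite lee_wpmul2l ?lee_fin ?(ltW c0)//; apply: leeD => //; exact: leeD.
Qed.

Lemma luxemburg_ge0 (x : int * int) : (0 <= lux x)%E.
Proof. by apply: le_ereal_inf_tmp => _ [l [l0 _] <-]; rewrite lee_fin ltW. Qed.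

(** The infimum [l] may fail to be admissible, and may be 0, so the bound is applied to an
    admissible number below l + e / M and e tends to 0. *)
Lemma dVint_norm_le_lux j (x : int * int) (l : R) : lux x = l%:E ->
  (dVint alpha (Qwide x) (Phi_level j) <= (Vol (x.1 + 1))%:E)%E ->
  (dVint alpha (Qwide x) (fun z => (`|f z|)%:E) <=
   (l * (2 ^ j * (Phi 1 + 2) * Vol (x.1 + 1)))%:E)%E.
Proof.
move=> lE HX.
have V0 := Vol_gt0 alpha1 (x.1 + 1).
have j0 : 0 < 2 ^ j :> R by rewrite exprz_gt0.
have P1 : 0 <= Phi 1 by apply: Young_ge0.
set M := 2 ^ j * _ * _.
have P2 : 0 < Phi 1 + 2 by rewrite ltr_wpDl.
have M0 : 0 < M by rewrite /M mulr_gt0// mulr_gt0.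
apply/lee_addgt0Pr => e e0.
have eM0 : 0 < e / M by rewrite divr_gt0.
have lt1 : (lux x < (l + e / M)%:E)%E by rewrite lE lte_fin ltrDl.
have [_ [s [s0 Hs] <-]] := ereal_inf_lt lt1; rewrite lte_fin => sl.
rewrite volQ_wide//= in Hs.
apply: le_trans (dVint_norm_le_lux_adm s0 Hs HX) _.
rewrite -EFinD lee_fin -/M.
have -> : l * M + e = (l + e / M) * M by field; rewrite gt_eqF.
by rewrite ler_pM2r// ltW.
Qed.

End one_box.

(** * Summation over boxes *)

Lemma int_add_large (c j : int) : exists n : nat, c <= j + n%:Z /\ 0 <= j + n%:Z.
Proof. by exists (`|c| + `|j|)%N; split; lia. Qed.

(** The exponent q g is split as q / p + q (g - 1/p); with g = gamma / (2 + alpha) the last factor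
    is the power of the volume in the test condition. *)
Lemma powR_rescale (R : realType) (p q g c t V : R) : 0 < p -> 0 <= c -> 0 <= t -> 0 < V ->
  (c * (t * V `^ g)) `^ q = c `^ q * (t `^ p * V) `^ (q / p) * V `^ (q * (g - p^-1)).
Proof.
move=> p0 c0 t0 V0; have V0' := ltW V0.
have Vg0 : 0 <= V `^ g by exact: powR_ge0.
have tp0 : 0 <= t `^ p by exact: powR_ge0.
have tV0 : 0 <= t * V `^ g by exact: mulr_ge0.
rewrite (powRM _ c0 tV0) (powRM _ t0 Vg0) (powRM _ tp0 V0') -(powRrM V) -(powRrM t).
have -> : p * (q / p) = q by rewrite mulrC divfK// gt_eqF.
rewrite -!mulrA; congr (_ * (_ * _)).
rewrite -powRD; last by rewrite (gt_eqF V0) implybT.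
by congr powR; ring.
Qed.

Section sum_over_boxes.
Variables (R : realType) (alpha p q gamma : R) (Phi : R -> R) (omega f : R * R -> R).
Variable mu : {measure set (R * R) -> \bar R}.
Hypotheses (alpha1 : -1 < alpha) (p1 : 1 < p) (pq : p <= q).
Hypotheses (gamma2 : gamma < 2 + alpha) (YPhi : Young Phi).
Hypotheses (mo : measurable_fun Hplane omega) (o0 : forall z, Hplane z -> 0 <= omega z).
Hypothesis mf : measurable_fun Hplane f.

Local Notation Vol := (Vol alpha).
Local Notation lux x := (luxemburg alpha (compl Phi) (winv omega)
  (x.2%:~R * 2 ^ x.1) ((x.2 + 2)%:~R * 2 ^ x.1) true true).
Local Notation X j A := (dVint alpha A (Phi_level Phi omega f j)).

Variable C : R.
Hypothesis C0 : 0 < C.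
Hypothesis test : forall x : int * int,
  ((Vol (x.1 + 1) `^ (q * (gamma / (2 + alpha) - p^-1)))%:E *
   poweR (lux x) q * mu (Qwide x) <= C%:E)%E.

Variables D N : R.
Hypothesis D0 : 0 <= D.
Hypothesis HD : forall g, 0 <= g -> forall js : seq int, uniq js ->
  \sum_(j <- js) (2 ^ j) `^ p * Phi_above Phi j g <= D * g `^ p.
Hypothesis HN : dVint alpha Hplane (fun z => (`|f z * omega z| `^ p)%:E) = N%:E.

Let p0 : 0 < p. Proof. exact: lt_trans ltr01 p1. Qed.
Let q0 : 0 < q. Proof. exact: lt_le_trans p0 pq. Qed.

Lemma measurable_Qwide x : measurable (@Qwide R x).
Proof. exact: measurable_Qbox. Qed.

Lemma Qwide_Hplane x : @Qwide R x `<=` Hplane.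
Proof. exact: Qbox_Hplane. Qed.

Let mPl j A : measurable A -> A `<=` Hplane -> measurable_fun A (Phi_level Phi omega f j).
Proof.
move=> mA AH; apply: measurable_funS (measurable_Phi_level YPhi mo mf j) => //.
exact: measurable_Hplane.
Qed.

Lemma measurable_fw_powR :
  measurable_fun Hplane (fun z => (`|f z * omega z| `^ p)%:E).
Proof.
apply/measurable_EFinP; apply: (@measurable_comp _ _ _ _ _ _ setT (fun r : R => r `^ p)) => //.
exact: measurable_norm_fw.
Qed.

Lemma sum_Phi_level_le (js : seq int) : uniq js ->
  (\sum_(j <- js) ((2 ^ j) `^ p)%:E * X j Hplane <= (D * N)%:E)%E.
Proof.
move=> ujs; have mH := @measurable_Hplane R.
have mP j : measurable_fun Hplane (Phi_level Phi omega f j) by exact: mPl.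
rewrite EFinM -HN -dVintZl//; last first.
  exact: measurable_fw_powR.
rewrite (eq_bigr (fun j => dVint alpha Hplane (fun z =>
   ((2 ^ j) `^ p)%:E * Phi_level Phi omega f j z)%E)); last first.
  by move=> j _; rewrite dVintZl ?powR_ge0// => z _; exact: Phi_level_ge0.
rewrite -dVint_sum//; first last.
- by move=> j z _; apply: mule_ge0; [rewrite lee_fin powR_ge0|exact: Phi_level_ge0].
- by move=> j; apply: emeasurable_funM.
apply: le_dVint => //.
- move=> z _; apply: sume_ge0 => j _.
  by apply: mule_ge0; [rewrite lee_fin powR_ge0|exact: Phi_level_ge0].
- by apply: emeasurable_sum => j; apply: emeasurable_funM.
- by apply: emeasurable_funM => //; exact: measurable_fw_powR.
- move=> z _; rewrite -EFinM.
  rewrite (eq_bigr (fun j => ((2 ^ j) `^ p * Phi_above Phi j `|f z * omega z|)%:E)); last by [].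
  by rewrite sumEFin lee_fin; exact: HD.
Qed.

Let X_ge0 j A : (0 <= X j A)%E.
Proof. by apply: dVint_ge0 => z _; exact: Phi_level_ge0. Qed.

(** A single term of [sum_Phi_level_le] bounds 2^(j p) times the integral by D N, and 2^(j p) >= 2^j
    >= j exceeds D N / V once j is large. *)
Lemma Phi_level_eventually_small (V : R) (j0 : int) : 0 < V ->
  exists n : nat, (X (j0 + n%:Z) Hplane <= V%:E)%E.
Proof.
move=> V0; set W := D * N / V.
have [n [jc j00]] := int_add_large (Num.ceil W) j0; exists n.
set j := j0 + n%:Z in jc j00 *.
have jW : W <= 2 ^ j.
  have [W0|W0] := leP W 0; first by apply: (le_trans W0); rewrite exprz_ge0.
  apply: (le_trans (ceil_ge W)); apply: (@le_trans _ _ j%:~R); first by rewrite ler_int.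
  case: (j) j00 => // m _; rewrite -exprnP -pmulrn -natrX ler_nat.
  exact/ltnW/ltn_expl.
have j1 : 1 <= 2 ^ j :> R.
  by case: (j) j00 => // m _; rewrite -exprnP exprn_ege1// ler1n.
have jp : W <= (2 ^ j) `^ p.
  by apply: (le_trans jW); rewrite le1r_powR// ltW.
have := @sum_Phi_level_le [:: j] isT; rewrite big_seq1.
have pj0 : 0 < (2 ^ j) `^ p :> R by rewrite powR_gt0// exprz_gt0.
rewrite -lee_pdivlMl// => /le_trans; apply.
rewrite -EFinM lee_fin mulrC ler_pdivrMr//.
by rewrite [leRHS]mulrC -ler_pdivrMr.
Qed.

Definition box_average (x : int * int) : \bar R :=
  (((2 ^ (x.1 + 1)) `^ (- (2 + alpha - gamma)))%:E *
   dVint alpha (Qwide x) (fun z => (`|f z|)%:E))%E.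

Lemma box_average_ge0 x : (0 <= box_average x)%E.
Proof.
rewrite mule_ge0 ?lee_fin ?powR_ge0//.
by apply: dVint_ge0 => z _; rewrite lee_fin.
Qed.

(** The factor 2 pays for using level j + 1 in place of j, [Phi 1 + 2] comes from
    [dVint_norm_le_lux], and the power of 1 + alpha from writing side lengths as powers of [Vol]. *)
Definition avg_cst : R := 2 * (Phi 1 + 2) * (1 + alpha) `^ (gamma / (2 + alpha) - 1).

Lemma avg_cst_gt0 : 0 < avg_cst.
Proof.
rewrite /avg_cst mulr_gt0 ?powR_gt0//; last by have := alpha1; lra.
by rewrite mulr_gt0// ltr_wpDl// Young_ge0.
Qed.

Lemma avg_cstE j k : (2 ^ k) `^ (- (2 + alpha - gamma)) * (2 ^ (j + 1) * (Phi 1 + 2) * Vol k) =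
  avg_cst * (2 ^ j * Vol k `^ (gamma / (2 + alpha))).
Proof.
have a0 : 0 < 1 + alpha by have := alpha1; lra.
have a2 : 2 + alpha != 0 by rewrite gt_eqF//; have := alpha1; lra.
have L0 : 0 < 2 ^ k :> R by rewrite exprz_gt0.
have -> : 2 ^ (j + 1) = 2 * 2 ^ j :> R by rewrite (exp2_pred R (j + 1)) addrK.
have -> : (2 ^ k) `^ (- (2 + alpha - gamma)) = (2 ^ k) `^ gamma / (2 ^ k) `^ (2 + alpha) :> R.
  by rewrite -powRB ?(gt_eqF L0) ?implybT//; congr powR; lra.
have -> : Vol k `^ (gamma / (2 + alpha)) = (2 ^ k) `^ gamma / (1 + alpha) `^ (gamma / (2 + alpha)).
  rewrite /Vol powRM ?powR_ge0 ?invr_ge0 ?(ltW a0)// -powRrM.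
  have -> : (2 + alpha) * (gamma / (2 + alpha)) = gamma by rewrite mulrC divfK.
  by rewrite -(powR_inv1 (ltW a0)) -powRrM mulN1r powRN.
rewrite /avg_cst /Vol powRB ?(gt_eqF a0) ?implybT// powRr1 ?(ltW a0)//.
by field; rewrite !gt_eqF ?powR_gt0.
Qed.

(* [j] is a level such that the mean of [Phi_level j] over the box exceeds 1 but
   that of [Phi_level (j + 1)] does not, so that 2^j is comparable to the Orlicz
   norm of [f omega] on the box. *)
Lemma box_term_le x :
  (poweR (box_average x) q * mu (Qwide x) = 0)%E \/
  exists j, ((Vol (x.1 + 1))%:E <= X j (Qwide x))%E /\
    (poweR (box_average x) q * mu (Qwide x) <=
      (C * avg_cst `^ q * ((2 ^ j) `^ p * Vol (x.1 + 1)) `^ (q / p))%:E)%E.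
Proof.
set V := Vol _; have V0 : 0 < V by exact: Vol_gt0.
have L0 : 0 < 2 ^ (x.1 + 1) :> R by rewrite exprz_gt0.
have qn0 : q != 0 by rewrite gt_eqF.
set e := q * (gamma / (2 + alpha) - p^-1).
have Ve0 : 0 < V `^ e by rewrite powR_gt0.
have Hx := test x; rewrite -/V -/e in Hx.
have lux0 : (0 <= lux x)%E by exact: luxemburg_ge0.
(* If the Luxemburg norm is infinite, the test condition forces the box to be [mu]-null. *)
case lE : (lux x) lux0 => [l| |]//; last first.
  move=> _; left; move: Hx; rewrite lE poweRyr// gt0_muley ?lte_fin//.
  have [->|m0] := eqVneq (mu (Qwide x)) 0%E; first by rewrite !mule0.
  have mp : (0 < mu (Qwide x))%E by rewrite lt0e m0 measure_ge0.
  by rewrite gt0_mulye.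
rewrite lee_fin => l0.
have Ale j : (X j (Qwide x) <= V%:E)%E -> (box_average x <=
    (l * ((2 ^ (x.1 + 1)) `^ (- (2 + alpha - gamma)) * (2 ^ j * (Phi 1 + 2) * V)))%:E)%E.
  move=> HX; have := dVint_norm_le_lux alpha1 YPhi mo o0 mf lE HX.
  move=> /(lee_wpmul2l (_ : 0 <= ((2 ^ (x.1 + 1)) `^ (- (2 + alpha - gamma)))%:E)%E) H.
  apply: (le_trans (H _)); first by rewrite lee_fin powR_ge0.
  by rewrite -EFinM lee_fin mulrCA.
(* If the mean is at most 1 at every level, letting j tend to minus infinity in [Ale] shows that the
   average vanishes. *)
have [[j0 Hj0]|nj] := pselect (exists j, ~ (X j (Qwide x) <= V%:E)%E); last first.
  left; suff -> : box_average x = 0%E by rewrite poweR0r// mul0e.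
  apply/eqP; rewrite eq_le box_average_ge0 andbT.
  have Aj j : (X j (Qwide x) <= V%:E)%E by apply: contrapT => H; apply: nj; exists j.
  set m := (2 ^ (x.1 + 1)) `^ (- (2 + alpha - gamma)) * ((Phi 1 + 2) * V).
  have m0 : 0 <= l * m.
    have P1 : 0 <= Phi 1 + 2 by rewrite addr_ge0// (Young_ge0 YPhi).
    by rewrite mulr_ge0// mulr_ge0 ?powR_ge0// mulr_ge0// ltW.
  apply/lee_addgt0Pr => eps eps0; rewrite add0e.
  (* The summand 1 guards against [l * m] being 0. *)
  have lm0 : 0 < eps / (l * m + 1) by rewrite divr_gt0// ltr_wpDl.
  have [k /andP[k1 _]] := dyadic_scale lm0.
  apply: (le_trans (Ale (k - 1) (Aj _))); rewrite lee_fin.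
  apply: (@le_trans _ _ (2 ^ (k - 1) * (l * m + 1))).
    have k0 : 0 < 2 ^ (k - 1) :> R by rewrite exprz_gt0.
    rewrite [leLHS](_ : _ = 2 ^ (k - 1) * (l * m)); last by rewrite /m; ring.
    by rewrite ler_pM2l// lerDl.
  by rewrite -ler_pdivlMr// ltr_wpDl.
right.
(* The mean exceeds 1 at [j0] and no longer does at [j0 + n], so the change occurs at some level in
   between. *)
have [n Hn] := Phi_level_eventually_small j0 V0.
have [|j [Hj Hj1]] := @int_transition (fun j => ~ (X j (Qwide x) <= V%:E)%E) j0 n Hj0.
  move=> H; apply: H; apply: le_trans Hn.
  apply: dVint_subset => //; [exact: measurable_Qwide|exact: measurable_Hplane| | |exact: Qwide_Hplane].
    by apply: mPl => //; exact: measurable_Hplane.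
  by move=> z _; exact: Phi_level_ge0.
move/contrapT in Hj1.
exists j; split; first by rewrite ltW// ltNge; exact/negP.
have := Ale _ Hj1.
rewrite avg_cstE => Aj.
have c0 := avg_cst_gt0.
have j0' : 0 < 2 ^ j :> R by rewrite exprz_gt0.
set a := avg_cst * _ in Aj.
have a0 : 0 <= a.
  by apply: mulr_ge0; [exact: ltW|apply: mulr_ge0; [exact: ltW|exact: powR_ge0]].
have aq : a `^ q = avg_cst `^ q * ((2 ^ j) `^ p * V) `^ (q / p) * V `^ e.
  by apply: powR_rescale => //; exact: ltW.
apply: (@le_trans _ _ (poweR (l * a)%:E q * mu (Qwide x))%E).
  rewrite lee_wpmul2r//; apply: gt0_ler_poweR => //; first exact: ltW.
  - by rewrite in_itv/= box_average_ge0 leey.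
  - by rewrite in_itv/= lee_fin mulr_ge0// leey.
rewrite poweR_EFin powRM// aq.
(* Regrouped so that V^e, l^q and the measure of the box form the left side of the test
   condition. *)
have -> : ((l `^ q * (avg_cst `^ q * ((2 ^ j) `^ p * V) `^ (q / p) * V `^ e))%:E * mu (Qwide x) =
  (avg_cst `^ q * ((2 ^ j) `^ p * V) `^ (q / p))%:E * ((V `^ e)%:E * poweR l%:E q * mu (Qwide x)))%E.
  rewrite poweR_EFin muleA muleA -!EFinM; congr (_%:E * _)%E; ring.
rewrite lE in Hx.
apply: le_trans (lee_wpmul2l _ Hx) _; first by rewrite lee_fin mulr_ge0 ?powR_ge0.
by rewrite -EFinM lee_fin mulrC mulrA.
Qed.

Let W : R := 16 / (1 - 2 * volr alpha).

Let W0 : 0 <= W. Proof. by rewrite divr_ge0// ltW// volr_lt. Qed.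

Let N0 : 0 <= N.
Proof. by rewrite -lee_fin -HN; apply: dVint_ge0 => z _; rewrite lee_fin powR_ge0. Qed.

(** Group the boxes by selected level. At level j their total volume is at most W times the integral
    of S_j by [Qwide_weak_type], and [sum_Phi_level_le] sums over the levels. *)
Lemma level_sum_le (J : int * int -> option int) (s : seq (int * int)) : uniq s ->
  (forall x j, J x = Some j -> ((Vol (x.1 + 1))%:E <= X j (Qwide x))%E) ->
  \sum_(x <- s) (if J x is Some j then (2 ^ j) `^ p * Vol (x.1 + 1) else 0) <= W * (D * N).
Proof.
move=> us HJ; pose js := undup (pmap J s).
have ujs : uniq js by exact: undup_uniq.
have -> : \sum_(x <- s) (if J x is Some j then (2 ^ j) `^ p * Vol (x.1 + 1) else 0) =
  \sum_(j <- js) (2 ^ j) `^ p * \sum_(x <- s | J x == Some j) Vol (x.1 + 1).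
  under [RHS]eq_bigr do rewrite big_mkcond mulr_sumr.
  rewrite exchange_big/= big_seq [RHS]big_seq; apply: eq_bigr => x xs.
  case Jx : (J x) => [j|]; last by rewrite big1// => j _; rewrite mulr0.
  have jjs : j \in js by rewrite mem_undup mem_pmap -Jx map_f.
  rewrite (bigD1_seq j)//= eqxx big1 ?addr0// => i ij.
  by rewrite eqE/= eq_sym (negbTE ij) mulr0.
rewrite -lee_fin -sumEFin.
apply: (@le_trans _ _ (\sum_(j <- js) W%:E * (((2 ^ j) `^ p)%:E * X j Hplane))%E); last first.
  rewrite -ge0_sume_distrr; last by move=> j _; rewrite mule_ge0// lee_fin powR_ge0.
  by rewrite [leRHS]EFinM lee_wpmul2l ?lee_fin// sum_Phi_level_le.
apply: lee_sum => j _; rewrite EFinM muleCA lee_wpmul2l ?lee_fin ?powR_ge0//.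
rewrite -big_filter; apply: (Qwide_weak_type alpha1).
- by apply: mPl => //; exact: measurable_Hplane.
- by move=> z _; exact: Phi_level_ge0.
- exact: filter_uniq.
- by move=> x; rewrite mem_filter => /andP[/eqP Jx _]; exact: HJ.
Qed.

(** As q / p >= 1 and each term B is at most the bound M of the whole sum, B^(q/p) <= M^(q/p - 1) B,
    which leaves the sum of B. *)
Lemma sum_box_terms_le (s : seq (int * int)) : uniq s ->
  (\sum_(x <- s) (poweR (box_average x) q * mu (Qwide x)) <=
   (C * avg_cst `^ q * (W * (D * N)) `^ (q / p))%:E)%E.
Proof.
move=> us.
have /choice[J HJ] : forall x, exists o : option int, match o with
   | None => (poweR (box_average x) q * mu (Qwide x) = 0)%E
   | Some j => ((Vol (x.1 + 1))%:E <= X j (Qwide x))%E /\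
    (poweR (box_average x) q * mu (Qwide x) <=
      (C * avg_cst `^ q * ((2 ^ j) `^ p * Vol (x.1 + 1)) `^ (q / p))%:E)%E end.
  by move=> x; have [H|[j H]] := box_term_le x; [exists None|exists (Some j)].
pose B x := if J x is Some j then (2 ^ j) `^ p * Vol (x.1 + 1) else 0.
set M := W * (D * N).
have sB t : uniq t -> \sum_(x <- t) B x <= M.
  by move=> ut; apply: level_sum_le => // x j Jx; have := HJ x; rewrite Jx => -[].
have B0 x : 0 <= B x.
  by rewrite /B; case: (J x) => // j; rewrite mulr_ge0 ?powR_ge0// ltW// Vol_gt0.
have BM x : B x <= M by have := sB [:: x] isT; rewrite big_seq1.
have M0 : 0 <= M by rewrite /M mulr_ge0// mulr_ge0.
have qp0 : 0 < q / p by rewrite divr_gt0.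
have qp1 : 0 <= q / p - 1 by rewrite subr_ge0 ler_pdivlMr// mul1r.
have C1 : 0 <= C * avg_cst `^ q by rewrite mulr_ge0 ?powR_ge0// ltW.
move: (C * avg_cst `^ q) C1 HJ => C' C1 HJ.
apply: (@le_trans _ _ (\sum_(x <- s) (C' * M `^ (q / p - 1) * B x)%:E)%E).
  apply: lee_sum => x _; apply: (@le_trans _ _ (C' * B x `^ (q / p))%:E).
    rewrite /B; have := HJ x; case: (J x) => [j [] //|->].
    by rewrite lee_fin mulr_ge0 ?powR_ge0.
  rewrite lee_fin -mulrA ler_wpM2l// -(mulr_powRB1 (B0 x) qp0) mulrC ler_wpM2r//.
  by apply: ge0_ler_powR; rewrite ?nnegrE.
rewrite sumEFin lee_fin -mulr_sumr -(mulr_powRB1 M0 qp0) [M * _]mulrC mulrA.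
by rewrite ler_wpM2l ?sB// mulr_ge0 ?powR_ge0.
Qed.

(** * From the maximal function to the sum over boxes *)

Let avg (a b : R) ba bb : \bar R := (((b - a) `^ (- (2 + alpha - gamma)))%:E *
  dVint alpha (Qbox a b ba bb) (fun w => (`|f w|)%:E))%E.

(** Enlarging I to J with |J| <= 4 |I| increases the integral and costs 4^(2 + alpha - gamma) in the
    normalisation, the exponent being positive. *)
Lemma avg_le_box_average (a b : R) ba bb z : a < b -> Qbox a b ba bb z ->
  exists x, Qwide x z /\
    (0 <= avg a b ba bb <= (4 `^ (2 + alpha - gamma))%:E * box_average x)%E.
Proof.
move=> ab Qz.
have [x [Qx Lx]] := Qwide_cover ba bb ab.
rewrite /avg; exists x; split; first exact: Qx.
have dge0 A : (0 <= dVint alpha A (fun w => (`|f w|)%:E))%E.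
  by apply: dVint_ge0 => w _; rewrite lee_fin.
apply/andP; split; first by rewrite mule_ge0 ?lee_fin ?powR_ge0.
rewrite /box_average muleA -EFinM; apply: lee_pmul => //.
- by rewrite lee_fin powR_ge0.
- have L0 : 0 < 2 ^ (x.1 + 1) :> R by rewrite exprz_gt0.
  have l0 : 0 < b - a by rewrite subr_gt0.
  have s0 : 0 <= 2 + alpha - gamma by have := gamma2; lra.
  rewrite lee_fin !powRN ler_pdivlMr ?powR_gt0// mulrC ler_pdivrMr ?powR_gt0//.
  rewrite -powRM ?(ltW l0)//.
  by apply: ge0_ler_powR; rewrite ?nnegrE ?(ltW L0) ?mulr_ge0 ?(ltW l0).
- apply: dVint_subset => //.
  + exact: measurable_Qbox.
  + exact: measurable_Qwide.
  + apply/measurable_EFinP; apply: measurableT_comp => //.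
    by apply: measurable_funS mf; [exact: measurable_Hplane|exact: Qwide_Hplane].
Qed.

Let c4 : R := (4 `^ (2 + alpha - gamma)) `^ q.

Lemma integral_Mag_le :
  (\int[mu]_(z in Hplane) poweR (Mag alpha gamma f z) q <=
   (c4 * (C * avg_cst `^ q * (W * (D * N)) `^ (q / p)))%:E)%E.
Proof.
have c40 : 0 <= c4 by exact: powR_ge0.
(* The boxes enumerated by their codes in nat; an index that is no code contributes 0, and each box
   occurs once. *)
pose G n z := if pickle_inv n is Some x then
  (c4%:E * poweR (box_average x) q * (\1_(@Qwide R x) z)%:E)%E else 0%E.
have G0 n z : (0 <= G n z)%E.
  rewrite /G; case: pickle_inv => // x.
  by rewrite !mule_ge0 ?lee_fin ?poweR_ge0.
have cG z : cvgn (fun n => \sum_(0 <= i < n) G i z)%E.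
  by apply: is_cvg_nneseries => n _ _.
apply: (@le_trans _ _ (\int[mu]_(z in Hplane) \sum_(0 <= n <oo) G n z)%E).
  (* The comparison avoids measurability of [Mag], a supremum over uncountably many boxes. *)
  apply: ge0_le_integral_nonmeas => z Hz; first exact: poweR_ge0.
  set T := (\sum_(0 <= n <oo) _)%E.
  have T0 : (0 <= T)%E by apply: nneseries_ge0 => n _ _.
  (* Bounding each average by the q-th root of the sum lets the supremum be taken before raising to
     the power q. *)
  have vT a b ba bb : a < b -> Qbox a b ba bb z ->
     (0 <= avg a b ba bb <= poweR T q^-1)%E.
    move=> ab /(avg_le_box_average ab)[x [Qxz]].
    move: (avg a b ba bb) => v /andP[v0 vx]; rewrite v0/=.
    have -> : v = poweR (poweR v q) q^-1.
      by rewrite -poweRrM divff ?gt_eqF// poweRe1.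
    apply: gt0_ler_poweR.
    - by rewrite invr_ge0 ltW.
    - by rewrite in_itv/= poweR_ge0 leey.
    - by rewrite in_itv/= T0 leey.
    apply: (@le_trans _ _ (G (pickle x) z)).
      rewrite /G pickleK_inv indicE mem_set// mule1 -poweR_EFin -poweRM ?box_average_ge0 ?lee_fin ?powR_ge0//.
      apply: gt0_ler_poweR => //; first exact: ltW.
        by rewrite in_itv/= v0 leey.
      by rewrite in_itv/= mule_ge0 ?box_average_ge0 ?lee_fin ?powR_ge0// leey.
    rewrite /T (nneseriesD1 (n := pickle x))// leeDl//.
    by apply: nneseries_ge0 => n _ _.
  have M0 : (0 <= Mag alpha gamma f z)%E.
    have z2 : 0 < z.2 := Hz.
    (* Some box contains z, since its side 2 z.2 exceeds the height z.2; hence the supremum is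
       nonnegative, as monotonicity of [poweR] requires. *)
    have ab : z.1 - z.2 < z.1 + z.2 by lra.
    have Qz : Qbox (z.1 - z.2) (z.1 + z.2) true true z.
      by rewrite QboxE; split; apply/andP; split; lra.
    have /andP[v0 _] := vT _ _ _ _ ab Qz.
    apply: (le_trans v0); apply: ereal_sup_ubound.
    by exists (z.1 - z.2), (z.1 + z.2), true, true.
  have MT : (Mag alpha gamma f z <= poweR T q^-1)%E.
    apply: ge_ereal_sup => _ [a [b [ba [bb [ab Qz ->]]]]].
    by have /andP[] := vT _ _ _ _ ab Qz.
  have -> : T = poweR (poweR T q^-1) q.
    by rewrite -poweRrM mulVf ?gt_eqF// poweRe1.
  apply: gt0_ler_poweR => //; first exact: ltW.
    by rewrite in_itv/= M0 leey.
  by rewrite in_itv/= poweR_ge0 leey.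
have mG n : measurable_fun Hplane (G n).
  rewrite /G; case: pickle_inv => [x|]; last exact: measurable_cst.
  apply: emeasurable_funM => //; apply/measurable_EFinP.
  by apply: measurable_indic; exact: measurable_Qwide.
rewrite integral_nneseries//; last exact: measurable_Hplane.
apply: lime_le.
  apply: is_cvg_nneseries => n _ _; exact: integral_ge0.
apply: nearW => n.
(* The boxes with code below n: the partial sum becomes a sum over a finite duplicate-free list. *)
pose s := pmap (@pickle_inv (int * int)%type) (iota 0 n).
have us : uniq s by rewrite (pmap_uniq (@pickle_invK _))// iota_uniq.
apply: (@le_trans _ _ (c4%:E * \sum_(x <- s) (poweR (box_average x) q * mu (Qwide x)))%E); last first.
  by rewrite [leRHS]EFinM lee_wpmul2l ?lee_fin// sum_box_terms_le.
rewrite ge0_sume_distrr; last by move=> x _; rewrite mule_ge0 ?poweR_ge0.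
rewrite /s /index_iota subn0; elim: (iota 0 n) => [|i t IH]; first by rewrite !big_nil.
rewrite big_cons /=.
have Gi : (\int[mu]_(z in Hplane) G i z <= if pickle_inv i is Some x then
   c4%:E * (poweR (box_average x) q * mu (Qwide x)) else 0)%E.
  rewrite /G; case: pickle_inv => [x|]; last by rewrite integral0.
  rewrite ge0_integralZl ?mule_ge0 ?lee_fin ?poweR_ge0//; last first.
  - by apply/measurable_EFinP; apply: measurable_indic; exact: measurable_Qwide.
  - exact: measurable_Hplane.
  rewrite integral_indic; [|exact: measurable_Hplane|exact: measurable_Qwide].
  by rewrite (setIidl (@Qwide_Hplane x)) muleA.
case: (pickle_inv i) Gi => [x|] Gi /=; first by rewrite big_cons; exact: leeD.
by rewrite -[leRHS]add0e; exact: leeD.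
Qed.

End sum_over_boxes.

(** * Assembly of the constants *)

Unset Implicit Arguments.

Theorem theorem2p6 (R : realType) (alpha p q gamma : R) (Phi : R -> R)
    (omega : R * R -> R) (mu : {measure set (R * R) -> \bar R}) :
  -1 < alpha -> 1 < p -> p <= q -> 0 <= gamma -> gamma < 2 + alpha ->
  Young Phi -> Bp p Phi -> weight omega ->
  (exists C : R, 0 < C /\
     forall (a b : R) (ba bb : bool), a < b ->
       (poweR (volQ alpha a b ba bb) (q * (gamma / (2 + alpha) - p^-1)) *
        poweR (luxemburg alpha (compl Phi) (winv omega) a b ba bb) q *
        mu (Qbox a b ba bb) <= C%:E)%E) ->
  exists K : R, 0 < K /\
    forall f : R * R -> R,
      measurable_fun Hplane f ->
      (dVint alpha Hplane (fun z => (`|f z| `^ p * omega z)%:E) < +oo)%E ->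
      (poweR (\int[mu]_(z in Hplane) poweR (Mag alpha gamma f z) q) q^-1
       <= K%:E * poweR (dVint alpha Hplane
                          (fun z => (`|f z * omega z| `^ p)%:E)) p^-1)%E.
Proof.
move=> alpha1 p1 pq _ gamma2 YPhi BPhi [mo o0 _] [C [C0 test]].
have p0 : 0 < p by exact: lt_trans p1.
have q0 : 0 < q by exact: lt_le_trans pq.
have [D D0 HD] := sum_Phi_above p1 YPhi BPhi.
pose c := (4 `^ (2 + alpha - gamma)) `^ q * (C * avg_cst alpha gamma Phi `^ q).
have c0 : 0 <= c by rewrite /c mulr_ge0 ?powR_ge0// mulr_ge0 ?powR_ge0// ltW.
pose W := 16 / (1 - 2 * volr alpha).
have W0 : 0 <= W by rewrite /W divr_ge0// ltW// volr_lt.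
pose K := c `^ q^-1 * (W * D) `^ p^-1.
have K0 : 0 <= K by rewrite mulr_ge0 ?powR_ge0.
(* [D] is only known to be nonnegative, so [K] may be 0 and 1 is added for positivity. *)
exists (K + 1); split; first by rewrite ltr_wpDl.
move=> f mf _.
have : (0 <= dVint alpha Hplane (fun z => (`|f z * omega z| `^ p)%:E))%E.
  by apply: dVint_ge0 => z _; rewrite lee_fin powR_ge0.
(* If the norm of [f omega] is infinite, so is the right-hand side. *)
case HN : (dVint _ _ _) => [N| |]//; last first.
  by move=> _; rewrite poweRyr ?invr_eq0 ?gt_eqF// gt0_muley ?lte_fin ?leey// ltr_wpDl.
rewrite lee_fin => N0.
have test' (x : int * int) : ((Vol alpha (x.1 + 1) `^ (q * (gamma / (2 + alpha) - p^-1)))%:E *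
   poweR (luxemburg alpha (compl Phi) (winv omega)
     (x.2%:~R * 2 ^ x.1) ((x.2 + 2)%:~R * 2 ^ x.1) true true) q * mu (Qwide x) <= C%:E)%E.
  rewrite -poweR_EFin -(volQ_wide alpha1); apply: test.
  by rewrite ltr_pM2r ?exprz_gt0// ltr_int ltrDl.
have HM := integral_Mag_le alpha1 p1 pq gamma2 YPhi mo o0 mf C0 test' D0 HD HN.
apply: (@le_trans _ _ (poweR (c * (W * (D * N)) `^ (q / p))%:E q^-1)).
  apply: gt0_ler_poweR.
  - by rewrite invr_ge0 ltW.
  - by rewrite in_itv/= leey andbT integral_ge0// => z _; exact: poweR_ge0.
  - by rewrite in_itv/= leey andbT lee_fin mulr_ge0 ?powR_ge0.
  - by rewrite /c -mulrA.
rewrite !poweR_EFin -EFinM lee_fin powRM ?powR_ge0// -powRrM.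
have -> : q / p * q^-1 = p^-1 by field; rewrite !gt_eqF.
rewrite mulrA (powRM _ (mulr_ge0 W0 D0) N0) mulrA -/K.
by rewrite ler_wpM2r ?powR_ge0// lerDl.
Qed.
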